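(* Consider the multi-queue bandit and the algorithm Q-ThS(match) described in the context, with any problem instance $(\boldsymbol\lambda,\boldsymbol\mu)$ satisfying the stated assumptions. For $u\in[U]$ let $$w(t)=\exp\left(\left(\frac{2\log t}{\Delta}\right)^{2/3}\right),\quad v'_u(t)=\frac{6K}{\epsilon_u}w(t),\quad v_u(t)=\frac{24}{\epsilon_u^2}\log t+\frac{60K}{\epsilon_u}\frac{v'_u(t)\log^2 t}{t}.$$ Then there exist constants $C>0$ and $t_0$, not depending on $K$ or on the $\epsilon_u$, such that under Q-ThS(match), for every $u\in[U]$, $$\Psi_u(t)\le C\,\frac{K\,v_u(t)\log^2 t}{t}$$ for all $t>t_0$ satisfying $\frac{w(t)}{\log t}\ge\frac{2}{\epsilon_u}$, $t\ge\exp(6/\Delta^2)$ and $v_u(t)+v'_u(t)\le t/2$.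
   Context: Discrete-time system with $U$ queues and $K$ servers, $1\le U\le K$. Arrivals $A_u(t)\in\{0,1\}$ to queue $u$ are Bernoulli($\lambda_u$), and the service $R_{uk}(t)\in\{0,1\}$ that server $k$ offers queue $u$ at time $t$ is Bernoulli($\mu_{uk}$); all these variables are mutually independent and i.i.d. across time slots. In each slot a matching between queues and servers is scheduled (each server serves at most one queue, each queue is served by at most one server); $\kappa_u(t)$ denotes the server assigned to queue $u$, $S_u(t)=R_{u\kappa_u(t)}(t)$ (0 if unassigned), and $Q_u(t)=(Q_u(t-1)+A_u(t)-S_u(t))^+$. Decisions are based only on past observations. Assumptions: for each $u$, $\mu^*_u=\max_k\mu_{uk}$ is attained at a unique server $k^*_u$; $k^*_u\ne k^*_{u'}$ for $u\ne u'$; and $\epsilon_u=\mu^*_u-\lambda_u>0$. The genie queue $Q^*_u$ uses the same arrivals and always server $k^*_u$. $Q_u(0)$ and $Q^*_u(0)$ are both distributed according to the stationary distribution of $Q^*_u$. Regret: $\Psi_u(t)=\mathbb{E}[Q_u(t)-Q^*_u(t)]$. $\Delta=\min_{u,\,k\ne k^*_u}(\mu^*_u-\mu_{uk})$. Algorithm Q-ThS(match): $\mathcal E$ is a fixed set of $K$ matchings which together cover every pair $(u,k)$. $T_{uk}(t)$ is the number of slots in $\{1,\dots,t\}$ in which server $k$ was assigned to queue $u$, and $\hat\mu_{uk}(t)$ the empirical mean of observed services of pair $(u,k)$ before $t$. At time $t$ draw an independent Bernoulli $\mathsf E(t)$ of mean $\min\{1,3K\log^2t/t\}$. If $\mathsf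 E(t)=1$, schedule a matching from $\mathcal E$ uniformly at random. Otherwise draw independently $\hat\theta_{uk}(t)\sim\mathrm{Beta}(\hat\mu_{uk}(t)T_{uk}(t-1)+1,(1-\hat\mu_{uk}(t))T_{uk}(t-1)+1)$, let $\hat k_u(t)=\arg\max_k\hat\theta_{uk}(t)$, and schedule a matching $\boldsymbol\kappa(t)$ minimizing $\sum_u\mathbf 1\{\kappa_u\ne\hat k_u(t)\}$ over all matchings. *)

(* Defs.v *)
From HB Require Import structures.
From mathcomp Require Import all_boot all_order all_algebra.
From mathcomp Require Import all_classical all_reals all_analysis.
From mathcomp Require Import beta_distribution.

Set Implicit Arguments.
Unset Strict Implicit.
Unset Printing Implicit Defensive.

Import Order.TTheory GRing.Theory Num.Def Num.Theory.
Local Open Scope classical_set_scope.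
Local Open Scope ring_scope.

(* Matchings between U queues and K servers: kappa u = Some k means server  *)
(* k is assigned to queue u, None means queue u is unassigned.  Each queue  *)
(* gets at most one server by construction; each server serves at most one *)
(* queue by the predicate below.                                            *)
Definition is_matching (U K : nat) (m : 'I_U -> option 'I_K) : Prop :=
  forall u u' k, m u = Some k -> m u' = Some k -> u = u'.

Definition mismatch (U K : nat) (m kh : 'I_U -> option 'I_K) : nat :=
  \sum_(u < U) (m u != kh u).

Definition min_mismatch_selector (U K : nat)
  (sel : nat -> ('I_U -> option 'I_K) -> ('I_U -> option 'I_K)) : Prop :=
  forall t kh, is_matching (sel t kh) /\
    forall m, is_matching m -> (mismatch (sel t kh) kh <= mismatch m kh)%N.

Definition exploration_set (U K : nat) (Ecal : 'I_K -> 'I_U -> option 'I_K) :=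
  (forall i, is_matching (Ecal i)) /\
  (forall u k, exists i, Ecal i u = Some k).

(* Q-ThS(match), as a deterministic function of the primitive randomness.  *)
(*   Arr u t w      : arrival A_u(t)                                        *)
(*   Srv u k t w    : service R_uk(t) offered by server k to queue u        *)
(*   Coin t w       : the exploration indicator E(t)                        *)
(*   Pick t w       : index of the matching of E picked at random at time t *)
(*   Theta u k t a b w : a Beta(a,b) draw reserved for pair (u,k) at time t *)
(*                    when the posterior parameters are (a,b); the         *)
(*                    algorithm uses Theta u k t (succ+1) (fail+1).         *)
Section Algorithm.
Variables (R : realType) (U K : nat) (T : Type).
Variable Ecal : 'I_K -> 'I_U -> option 'I_K.
Variable sel : nat -> ('I_U -> option 'I_K) -> ('I_U -> option 'I_K).
Variable Srv : 'I_U -> 'I_K -> nat -> T -> bool.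
Variable Coin : nat -> T -> bool.
Variable Pick : nat -> T -> 'I_K.
Variable Theta : 'I_U -> 'I_K -> nat -> nat -> nat -> T -> R.

(* counts of observed successes / failures of pair (u,k) *)
Definition counts : Type := (('I_U -> 'I_K -> nat) * ('I_U -> 'I_K -> nat))%type.

(* khat_u(t) = argmax_k theta_uk(t) (first maximizer in enumeration order) *)
Definition khat (t : nat) (c : counts) (w : T) : 'I_U -> option 'I_K :=
  fun u => [pick k : 'I_K | [forall k' : 'I_K,
       Theta u k' t (c.1 u k').+1 (c.2 u k').+1 w <=
       Theta u k t (c.1 u k).+1 (c.2 u k).+1 w]].

(* the matching scheduled at time t >= 1, given the counts over 1..t-1 *)
Definition sched_of (t : nat) (c : counts) (w : T) : 'I_U -> option 'I_K :=
  if Coin t w then Ecal (Pick t w) else sel t (khat t c w).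

Fixpoint hist (t : nat) (w : T) : counts :=
  match t with
  | 0 => (fun _ _ => 0%N, fun _ _ => 0%N)
  | t'.+1 =>
    let c := hist t' w in
    let m := sched_of t'.+1 c w in
    (fun u k => (c.1 u k + ((m u == Some k) && Srv u k t'.+1 w))%N,
     fun u k => (c.2 u k + ((m u == Some k) && ~~ Srv u k t'.+1 w))%N)
  end.

(* kappa(t), for t >= 1 *)
Definition sched (t : nat) (w : T) : 'I_U -> option 'I_K :=
  sched_of t (hist t.-1 w) w.

Definition served (u : 'I_U) (t : nat) (w : T) : bool :=
  if sched t w u is Some k then Srv u k t w else false.

End Algorithm.

Fixpoint queue (T : Type) (Q0 : T -> nat)
    (Arr : nat -> T -> bool) (S : nat -> T -> bool) (t : nat) (w : T) : nat :=
  match t with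
  | 0 => Q0 w
  | t'.+1 => (queue Q0 Arr S t' w + Arr t'.+1 w - S t'.+1 w)%N
  end.

(* Stationary distribution of the genie queue (Bernoulli(lam) arrivals,     *)
(* Bernoulli(mu) services, Q(t) = (Q(t-1)+A-S)^+).                          *)
Definition bern_w (R : realType) (p : R) (b : bool) : R := if b then p else 1 - p.

Definition genie_trans (R : realType) (lam mu : R) (q q' : nat) : R :=
  \sum_(a : bool) \sum_(s : bool)
     bern_w lam a * bern_w mu s * ((q + a - s)%N == q')%:R.

Definition is_stationary (R : realType) (lam mu : R) (pi : nat -> R) : Prop :=
  (forall n, 0 <= pi n) /\
  (\sum_(0 <= n <oo) (pi n)%:E = 1)%E /\
  (forall n, ((pi n)%:E = \sum_(0 <= m <oo) (pi m * genie_trans lam mu m n)%:E)%E).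

Definition mutually_independent (R : realType) (d : measure_display)
    (T : measurableType d) (P : probability T R) (I : eqType)
    (G : I -> set (set T)) : Prop :=
  forall (s : seq I) (A : I -> set T), uniq s ->
    (forall i, i \in s -> G i (A i)) ->
    P (\bigcap_(i in [set i | i \in s]) A i) = (\prod_(i <- s) P (A i))%E.

Definition gen_discrete (T S : Type) (X : T -> S) : set (set T) :=
  [set A | exists B : set S, A = X @^-1` B].
Definition gen_real (R : realType) (T : Type) (X : T -> R) : set (set T) :=
  [set A | exists2 B : set R, measurable B & A = X @^-1` B].

(* Index type of the primitive random variables:                            *)
(*   arrivals (u,t), services (u,k,t), coins t, picks t,                    *)
(*   Beta draws (u,k,t,a,b), initial queue lengths u.                       *)
Definition prim_index (U K : nat) : eqType :=
  (('I_U * nat) + ('I_U * 'I_K * nat) + nat + nat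
   + ('I_U * 'I_K * nat * nat * nat) + 'I_U)%type.

Definition prim_events (R : realType) (U K : nat) (T : Type)
    (Arr : 'I_U -> nat -> T -> bool) (Srv : 'I_U -> 'I_K -> nat -> T -> bool)
    (Coin : nat -> T -> bool) (Pick : nat -> T -> 'I_K)
    (Theta : 'I_U -> 'I_K -> nat -> nat -> nat -> T -> R)
    (Q0 : 'I_U -> T -> nat) (i : prim_index U K) : set (set T) :=
  match i with
  | inl (inl (inl (inl (inl (u, t))))) => gen_discrete (Arr u t)
  | inl (inl (inl (inl (inr (u, k, t))))) => gen_discrete (Srv u k t)
  | inl (inl (inl (inr t))) => gen_discrete (Coin t)
  | inl (inl (inr t)) => gen_discrete (Pick t)
  | inl (inr (u, k, t, a, b)) => gen_real (Theta u k t a b)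
  | inr u => gen_discrete (Q0 u)
  end.

Definition explore_prob (R : realType) (K t : nat) : R :=
  Num.min 1 (3 * K%:R * (ln (t%:R : R)) ^+ 2 / t%:R).

(* Main.v *)
Require Import Defs.
From HB Require Import structures.
From mathcomp Require Import all_boot all_order all_algebra.
From mathcomp Require Import all_classical all_reals all_analysis.
From mathcomp Require Import beta_distribution measurable_realfun.
From mathcomp Require Import ring lra zify.

(* Fix a queue and let tau be the last time before t at which it was empty.
   Since both queues start equal and share their arrivals, the regret at t is
   at most the number of slots in (tau, t] in which the queue was not given its best
   server.

   Past w(t) such a slot is an exploration slot, up to an event of superpolynomially
   small probability.  Indeed, when the exploration probability at s is below 1, the
   explorations of the slots s/2, ..., s already give each pair about log^2 s >=
   (2 log t / Delta)^(4/3) >> log t observations; the empirical means are then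
   accurate (exponential supermartingale, as the sampling is adaptive), the Beta
   samples are close to them (the density is bounded through one term of the binomial
   formula), every queue ranks its best server first, and the best servers form a
   matching.

   Finally t - tau <= v(t) with probability 1 - O(1/t^2): the net input over n slots
   has drift -eps n, and exponential moments absorb the w(t) initial slots, the
   explorations and the geometric initial queue.  So the regret is at most the
   expected number of explorations among the last v(t) slots plus O(1/t). *)

Set Implicit Arguments.
Unset Strict Implicit.
Unset Printing Implicit Defensive.

Import Order.TTheory GRing.Theory Num.Def Num.Theory.
Local Open Scope classical_set_scope.
Local Open Scope ring_scope.

(** * Elementary inequalities *)

Section RealInequalities.
Variable R : realType.
Implicit Types x p : R.

(** The obstacle is dependence: schedules, counts and queue lengths all feed back into each other.
    It is avoided in two ways. A busy period free of late mistakes is compared with arrivals, coins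
    and services of the best server only; these are independent primitives, so a plain Chernoff
    bound applies although the queue itself depends on the algorithm. Where the feedback cannot be
    removed, exponential moments are computed by integrating out one primitive variable at a time,
    which only requires that the other factors be measurable for the sigma-algebra of all the other
    variables.

    The bookkeeping aims at probability of order [t^-3] for each bad event: a union over the slots
    costs one factor [t], the crude bound [t] on the regret another, and the remaining [O(1/t)] is
    absorbed because [K v log^2 t >= 1]. *)

Lemma expR_le_quad x : x <= 2^-1 -> expR x <= 1 + x + x ^+ 2.
Proof.
move=> xh; have [x0|x0] := leP x 0.
  have : 1 - x <= expR (- x) by exact: expR_ge1Dx.
  rewrite expRN => h.
  have e0 := expR_gt0 x.
  have : (1 - x) * expR x <= 1.
    by rewrite -ler_pdivlMr// mul1r.
  move=> h2.
  have h3 : (1 - x) * expR x <= (1 - x) * (1 + x + x ^+ 2).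
    apply: (le_trans h2).
    have : x ^+ 3 <= 0 by rewrite exprS; nra.
    by move=> ?; nra.
  by rewrite -(@ler_pM2l _ (1 - x))//; lra.
(* For positive [x], the fourth power of [1 - x / 4] is a lower bound for [exp (- x)] sharp enough
   to leave a polynomial inequality, valid up to [x = 1/2]. *)
have h : 1 - x / 4 <= expR (- (x / 4)) by exact: expR_ge1Dx.
have h4 : (1 - x / 4) ^+ 4 <= expR (- x).
  rewrite (_ : - x = 4%:R * (- (x / 4))); last by lra.
  rewrite expRM_natl; apply: lerXn2r => //; rewrite ?nnegrE ?expR_ge0//; lra.
have e0 := expR_gt0 x.
have h2 : (1 - x / 4) ^+ 4 * expR x <= 1.
  by rewrite -ler_pdivlMr// mul1r -expRN.
have c0 : 0 < (1 - x / 4) ^+ 4 by apply: exprn_gt0; lra.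
rewrite -(ler_pM2l c0); apply: (le_trans h2).
have -> : (1 - x / 4) ^+ 4 * (1 + x + x ^+ 2) =
   1 + x ^+ 2 * (3/8 - 11/16 * x + x ^+ 2 * (81/256 - 15/256 * x) + x^+4/256).
  by field.
rewrite lerDl mulr_ge0 ?sqr_ge0//.
have : 0 <= x ^+ 2 * (81/256 - 15/256 * x) by rewrite mulr_ge0 ?sqr_ge0//; lra.
have : 0 <= x ^+ 4 by rewrite exprn_ge0// ltW.
lra.
Qed.

Lemma bernoulli_mgf_le p x : 0 <= p -> x <= 2^-1 ->
  1 + p * (expR x - 1) <= expR (p * (x + x ^+ 2)).
Proof.
move=> p0 /expR_le_quad h; apply: le_trans (expR_ge1Dx _).
by rewrite lerD2l ler_wpM2l//; lra.
Qed.

Lemma bernoulli_mgfN p : 0 <= p -> 1 + p * (expR (-1) - 1) <= expR (- (p / 2)).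
Proof.
move=> p0; apply: le_trans (expR_ge1Dx _); rewrite lerD2l.
have h : expR (-1) <= 2^-1 :> R.
  rewrite expRN lef_pV2 ?posrE ?expR_gt0//.
  by have := @expR_ge1Dx R 1; lra.
nra.
Qed.

Lemma harmonic_le_ln n : (0 < n)%N ->
  \sum_(1 <= s < n.+1) (s%:R : R)^-1 <= 1 + ln n%:R.
Proof.
case: n => // n _; elim: n => [|n IH].
  by rewrite big_nat1 invr1 ln1 addr0.
rewrite big_nat_recr//=; apply: (le_trans (lerD IH (lexx _))).
rewrite -addrA lerD2l.
have p1 : (0 : R) < n.+1%:R by rewrite ltr0n.
have p2 : (0 : R) < n.+2%:R by rewrite ltr0n.
have : ln (1 + (- n.+2%:R^-1)) <= - n.+2%:R^-1 :> R.
  by apply: le_ln1Dx; rewrite ltrN2 invf_lt1// ltr1n.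
have -> : 1 + (- n.+2%:R^-1) = n.+1%:R / n.+2%:R :> R.
  have e2 : n.+2%:R = n.+1%:R + 1 :> R by rewrite -natr1.
  move: p2; rewrite e2; move: (n.+1%:R : R) => z z0; field.
  exact: lt0r_neq0.
rewrite ln_div ?posrE//.
move: (ln (n.+1%:R : R)) (ln (n.+2%:R : R)) ((n.+2%:R : R)^-1) => a b c; lra.
Qed.

End RealInequalities.

(** * Countably valued measurable maps *)

Section DiscreteMeasurability.
Context (d : measure_display) (T : measurableType d).

(* Stands in for measurability when [S] carries no sigma-algebra: [X] factors
   through a countable measurable partition. *)
Definition dmeas (S : Type) (X : T -> S) : Prop :=
  exists (c : T -> nat) (g : nat -> S),
    (forall n, measurable [set w | c w = n]) /\ (forall w, X w = g (c w)).

Lemma dmeas_preimage (S : Type) (X : T -> S) (B : set S) :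
  dmeas X -> measurable (X @^-1` B).
Proof.
move=> [c [g [mc Xg]]].
have -> : X @^-1` B = \bigcup_(n in g @^-1` B) [set w | c w = n].
  apply/seteqP; split=> w /=; first by rewrite Xg => Bw; exists (c w).
  by move=> [n /= Bn cn]; rewrite Xg cn.
exact: bigcup_measurable.
Qed.

Lemma dmeas_measurable_fun (S : Type) (X : T -> S) d' (T' : measurableType d')
    (f : S -> T') : dmeas X -> measurable_fun setT (fun w => f (X w)).
Proof.
move=> mX _ B mB; rewrite setTI.
exact: (@dmeas_preimage S X (f @^-1` B)).
Qed.

Lemma dmeas_count (S : countType) (X : T -> S) :
  (forall x, measurable [set w | X w = x]) -> dmeas X.
Proof.
move=> mX.
exists (fun w => pickle (X w)), (fun n => odflt (X point) (unpickle n)); split=> [n|w].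
  have [[x xn]|nx] := pselect (exists x : S, pickle x = n).
    rewrite (_ : mkset _ = [set w | X w = x])//.
    apply/seteqP; split=> w /=; last by move=> ->.
    by rewrite -xn => /(pcan_inj pickleK).
  rewrite (_ : mkset _ = set0)//; apply/seteqP; split=> // w /= wn.
  by case: nx; exists (X w).
by rewrite pickleK.
Qed.

Lemma dmeas_bool (b : T -> bool) : measurable [set w | b w] -> dmeas b.
Proof.
move=> mb; apply: dmeas_count => -[].
  by [].
rewrite (_ : mkset _ = ~` [set w | b w]); first exact: measurableC.
by apply/seteqP; split=> w /=; [move=> ->|move/negP/negbTE].
Qed.

Lemma dmeas_cst (S : Type) (x : S) : dmeas (fun _ => x).
Proof.
exists (fun _ => 0%N), (fun _ => x); split=> // -[|n].
  by rewrite (_ : mkset _ = setT)//; apply/seteqP; split.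
by rewrite (_ : mkset _ = set0)//; apply/seteqP; split.
Qed.

Lemma dmeas_comp (S S' : Type) (f : S -> S') (X : T -> S) :
  dmeas X -> dmeas (fun w => f (X w)).
Proof.
by move=> [c [g [mc Xg]]]; exists c, (f \o g); split=> // w; rewrite /= Xg.
Qed.

(** Each cell of the partition of [X] is refined by the partition belonging to its own value, which
    stays countable. This makes adaptive choices measurable, such as Beta draws selected by the past
    counts. *)
Lemma dmeas_bind (S S' : Type) (X : T -> S) (Y : S -> T -> S') :
  dmeas X -> (forall x, dmeas (Y x)) -> dmeas (fun w => Y (X w) w).
Proof.
move=> [c [g [mc Xg]]] mY.
have /choice[cg cgP] n : exists cg : (T -> nat) * (nat -> S'),
    (forall m, measurable [set w | cg.1 w = m]) /\
    (forall w, Y (g n) w = cg.2 (cg.1 w)).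
  by have [c' [g' ?]] := mY (g n); exists (c', g').
have mp : dmeas (fun w => (c w, (cg (c w)).1 w)).
  apply: dmeas_count => -[n m].
  rewrite (_ : mkset _ = [set w | c w = n] `&` [set w | (cg n).1 w = m]).
    by apply: measurableI => //; exact: (cgP n).1.
  apply/seteqP; split=> w /=; first by move=> [-> <-].
  by move=> [-> ->].
have := dmeas_comp (fun nm : nat * nat => (cg nm.1).2 nm.2) mp.
congr dmeas; apply/funext => w /=.
by rewrite Xg (cgP (c w)).2.
Qed.

Lemma dmeas_pair (S S' : Type) (X : T -> S) (Y : T -> S') :
  dmeas X -> dmeas Y -> dmeas (fun w => (X w, Y w)).
Proof.
move=> mX mY; apply: (@dmeas_bind _ _ X (fun x w => (x, Y w))) => // x.
exact: dmeas_comp.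
Qed.

Lemma dmeas_comp2 (S1 S2 S' : Type) (f : S1 -> S2 -> S') (X : T -> S1) (Y : T -> S2) :
  dmeas X -> dmeas Y -> dmeas (fun w => f (X w) (Y w)).
Proof.
by move=> mX mY; have := dmeas_comp (fun p => f p.1 p.2) (dmeas_pair mX mY).
Qed.

Lemma dmeas_family (I : finType) (S : Type) (X : I -> T -> S) :
  (forall i, dmeas (X i)) -> dmeas (fun w i => X i w).
Proof.
move=> mX.
have /choice[cg cgP] i : exists cg : (T -> nat) * (nat -> S),
    (forall m, measurable [set w | cg.1 w = m]) /\
    (forall w, X i w = cg.2 (cg.1 w)).
  by have [c' [g' ?]] := mX i; exists (c', g').
have mp : dmeas (fun w => [ffun i => (cg i).1 w] : {ffun I -> nat}).
  apply: dmeas_count => f.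
  rewrite (_ : mkset _ = \bigcap_(i in [set: I]) [set w | (cg i).1 w = f i]).
    apply: fin_bigcap_measurable => // i _; exact: (cgP i).1.
  apply/seteqP; split=> w /=; first by move=> <- i _; rewrite /= ffunE.
  by move=> h; apply/ffunP => i; rewrite ffunE; apply: h.
have := dmeas_comp (fun (f : {ffun I -> nat}) i => (cg i).2 (f i)) mp.
by congr dmeas; apply/funext => w /=; apply/funext => i; rewrite ffunE (cgP i).2.
Qed.

Lemma dmeas_big (S : Type) (op : S -> S -> S) (x : S) (I : eqType) (s : seq I)
    (X : I -> T -> S) : (forall i, i \in s -> dmeas (X i)) ->
  dmeas (fun w => \big[op/x]_(i <- s) X i w).
Proof.
elim: s => [|i s IH] mX.
  by under eq_fun do rewrite big_nil; exact: dmeas_cst.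
under eq_fun do rewrite big_cons.
apply: dmeas_comp2; first by apply: mX; rewrite mem_head.
by apply: IH => j js; apply: mX; rewrite inE js orbT.
Qed.

End DiscreteMeasurability.

(** * Independence *)

Section Independence.
Context (R : realType) (d : measure_display) (T : measurableType d).
Variables (P : probability T R) (I : eqType) (G : I -> set (set T)).
Hypothesis mG : forall i A, G i A -> measurable A.
Hypothesis GI : forall i, setI_closed (G i).
Hypothesis GC : forall i A, G i A -> G i (~` A).
Hypothesis GT : forall i, G i setT.
Hypothesis indep : mutually_independent P G.

(* A pi-system generating the sigma-algebra of all the variables but [i0]. *)
Definition cylinders (i0 : I) : set (set T) :=
  [set A | exists (s : seq I) (F : I -> set T),
     [/\ i0 \notin s, forall i, G i (F i), forall i, i \notin s -> F i = setT
       & A = \bigcap_(i in [set i | i \in s]) F i]].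

Lemma cylinders_setI i0 : setI_closed (cylinders i0).
Proof.
move=> _ _ [s [F [is0 GF FT ->]]] [s' [F' [is0' GF' FT' ->]]].
exists (s ++ s'), (fun i => F i `&` F' i); split.
- by rewrite mem_cat negb_or is0.
- by move=> i; exact: GI.
- by move=> i; rewrite mem_cat negb_or => /andP[/FT -> /FT' ->]; rewrite setIT.
apply/seteqP; split=> w /=.
  move=> [h h'] i /= _; split.
    by have [/h//|/FT ->] := boolP (i \in s).
  by have [/h'//|/FT' ->] := boolP (i \in s').
move=> h; split=> i /= si.
  by have [] : (F i `&` F' i) w by apply: (h i); rewrite /= mem_cat si.
by have [] : (F i `&` F' i) w by apply: (h i); rewrite /= mem_cat si orbT.
Qed.

Lemma cylinders_measurable i0 : cylinders i0 `<=` measurable.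
Proof.
move=> _ [s [F [_ GF _ ->]]]; apply: fin_bigcap_measurable.
  exact: finite_seq.
by move=> i _; apply: mG (GF i).
Qed.

Lemma cylinders_gen i0 i A : i != i0 -> G i A -> cylinders i0 A.
Proof.
move=> ii0 GA; exists [:: i], (fun j => if j == i then A else setT); split.
- by rewrite inE eq_sym.
- by move=> j; case: eqP => [->|_].
- by move=> j; rewrite inE => /negbTE ->.
apply/seteqP; split=> w /=.
  by move=> Aw j /=; rewrite inE => ->.
by move=> /(_ i); rewrite /= inE eqxx; apply.
Qed.

Lemma indep_cylinders i0 A B : cylinders i0 A -> G i0 B ->
  P (A `&` B) = (P B * P A)%E.
Proof.
move=> [s [F [is0 GF FT ->]]] GB.
(* [mutually_independent] speaks of duplicate-free lists, so [s] is replaced by [undup s] before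
   [i0] joins it with the event [B]. *)
pose H i := if i == i0 then B else F i.
have HF i : i \in undup s -> H i = F i.
  by rewrite mem_undup /H; case: eqP => // ->; rewrite (negbTE is0).
have E1 : \bigcap_(i in [set i | i \in s]) F i `&` B =
  \bigcap_(i in [set i | i \in i0 :: undup s]) H i.
  apply/seteqP; split=> w /=.
    move=> [h Bw] i /=; rewrite inE => /orP[/eqP ->|iu]; first by rewrite /H eqxx.
    by rewrite HF//; apply: h; rewrite /= -mem_undup.
  move=> h; split=> [i /= si|].
    rewrite -HF ?mem_undup//; apply: h; rewrite /= inE mem_undup si orbT //.
  by have := h i0; rewrite /= inE eqxx /H eqxx; apply.
have E2 : \bigcap_(i in [set i | i \in s]) F i =
    \bigcap_(i in [set i | i \in undup s]) F i.
  by congr bigcap; apply/seteqP; split=> i /=; rewrite mem_undup.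
rewrite E1 indep; first last.
- by move=> i _; rewrite /H; case: eqP => [->//|_]; exact: GF.
- by rewrite /= mem_undup is0 undup_uniq.
rewrite big_cons {1}/H eqxx E2 indep ?undup_uniq//.
by congr (_ * _)%E; apply: eq_big_seq => i /HF ->.
Qed.

(** For fixed [B], the finite measures [P (A & B)] and [P B * P A] of [A] agree on the pi-system of
    cylinders, hence on the sigma-algebra it generates. *)
Lemma indep_sigma i0 A B : <<s cylinders i0 >> A -> G i0 B ->
  P (A `&` B) = (P B * P A)%E.
Proof.
move=> sA GB; have mB := mG GB.
have PB : P B \is a fin_num by exact: fin_num_measure.
have PB0 : 0 <= fine (P B) by exact: fine_ge0.
have mE C : (mscale (NngNum PB0) P) C = (P B * P C)%E.
  by rewrite /mscale /= fineK.
rewrite -mE -[LHS]/(mrestr P mB A).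
apply: (@g_sigma_algebra_measure_unique d R T (cylinders i0)
  (@cylinders_measurable i0) (fun=> setT) _ _ (mrestr P mB)
  (mscale (NngNum PB0) P) (@cylinders_setI i0)) => //.
- move=> _; exists [::], (fun=> setT); split=> //.
  by apply/seteqP; split.
- by apply/seteqP; split=> // x _; exists 0%N.
- move=> C cC; transitivity (P B * P C)%E; last exact/esym/mE.
  exact: indep_cylinders cC GB.
- move=> _; change (P (setT `&` B) < +oo)%E.
  by rewrite setTI -ge0_fin_numE.
Qed.

(** The carrier is still [T]: one and the same function can be [dmeas] for this sigma-algebra and
    for the original one. *)
Definition others (i0 : I) : measurableType _ := g_sigma_algebraType (cylinders i0).

Lemma others_measurable i0 (A : set T) : @measurable _ (others i0) A -> measurable A.
Proof.
by apply: smallest_sub; [exact: sigma_algebra_measurable|exact: cylinders_measurable].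
Qed.

Lemma others_dmeas i0 S (X : T -> S) : @dmeas _ (others i0) S X -> dmeas X.
Proof.
move=> [c [g [mc Xg]]]; exists c, g; split=> // n.
exact: (@others_measurable i0).
Qed.

Lemma others_gen i0 i A : i != i0 -> G i A -> @measurable _ (others i0) A.
Proof. by move=> ii0 GA; apply: sub_sigma_algebra; exact: cylinders_gen GA. Qed.

(** Since [M] takes countably many values, the integral is a series over its cells, and independence
    applies to each cell. *)
Lemma integral_indep i0 (B : set T) (M : T -> R) : G i0 B ->
  @dmeas _ (others i0) R M -> (forall w, 0 <= M w) ->
  (\int[P]_(w in B) (M w)%:E = P B * \int[P]_w (M w)%:E)%E.
Proof.
move=> GB mM M0; have mB := mG GB.
have [c [g [mc Mg]]] := mM.
have mc' n : measurable [set w : T | c w = n].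
  exact: (@others_measurable i0).
have mMT D : measurable D -> measurable_fun D (fun w => (M w)%:E).
  move=> mD; apply/measurable_funTS.
  exact: (dmeas_measurable_fun (@EFin R) (others_dmeas mM)).
(* [g] may be negative at indices that [c] never reaches; the maximum with 0 keeps every term of the
   series nonnegative. *)
have gE n w : c w = n -> M w = Num.max 0 (g n).
  by move=> <-; rewrite -Mg; apply/esym/max_idPr.
have key D : measurable D -> (\int[P]_(w in D) (M w)%:E =
    \sum_(n <oo) ((Num.max 0 (g n))%:E * P ([set w | c w = n] `&` D)))%E.
  move=> mD; have DE : D = \bigcup_n ([set w | c w = n] `&` D).
    by apply/seteqP; split=> w; [move=> Dw; exists (c w)|move=> [n _ []]].
  rewrite {1}DE ge0_integral_bigcup//.
  - apply: eq_eseriesr => n _.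
    rewrite -integral_cst; last exact: measurableI.
    by apply: eq_integral => w; rewrite inE => -[/= cw _]; rewrite (gE n).
  - by move=> n; apply: measurableI.
  - by rewrite -DE; exact: mMT.
  - by move=> w _; rewrite lee_fin.
  - apply/trivIsetP => i j _ _ ij; apply/seteqP; split=> // w [[/= ci _] [/= cj _]].
    by move: ij; rewrite -ci cj eqxx.
rewrite (key B)// (key setT)// -(fineK (fin_num_measure P _ mB)) -nneseriesZl.
  apply: eq_eseriesr => n _; rewrite (@indep_sigma i0)//; last exact: mc.
  by rewrite setIT fineK ?fin_num_measure// muleCA.
by move=> n _; rewrite mule_ge0// lee_fin le_max lexx.
Qed.

Lemma integral_peel i0 (b : T -> bool) (p x y : R) (M : T -> R) :
  G i0 [set w | b w] -> P [set w | b w] = p%:E ->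
  @dmeas _ (others i0) R M -> (forall w, 0 <= M w) -> 0 <= x -> 0 <= y ->
  (\int[P]_w (M w * (if b w then x else y))%:E =
   (p * x + (1 - p) * y)%:E * \int[P]_w (M w)%:E)%E.
Proof.
move=> GB PB mM M0 x0 y0; set B := [set w | b w].
have mB : measurable B := mG GB.
have mMD D (z : R) : measurable D -> measurable_fun D (fun w => (M w * z)%:E).
  move=> mD; apply/measurable_funTS.
  exact: (dmeas_measurable_fun (fun m => (m * z)%:E) (others_dmeas mM)).
have mMD1 D : measurable D -> measurable_fun D (fun w => (M w)%:E).
  move=> mD; apply/measurable_funTS.
  exact: (dmeas_measurable_fun (@EFin R) (others_dmeas mM)).
have I0 : (0 <= \int[P]_w (M w)%:E)%E by apply: integral_ge0 => w _; rewrite lee_fin.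
have bB w : (w \in B) = b w by apply/idP/idP; rewrite inE.
have piece (D : set T) (z : R) : measurable D -> 0 <= z ->
    (forall w, D w -> (if b w then x else y) = z) ->
    (\int[P]_(w in D) (M w * (if b w then x else y))%:E =
     z%:E * \int[P]_(w in D) (M w)%:E)%E.
  move=> mD z0 Dz; rewrite -ge0_integralZl ?lee_fin//; last 2 first.
  - exact: mMD1.
  - by move=> w _; rewrite lee_fin.
  by apply: eq_integral => w; rewrite inE => /Dz ->; rewrite EFinM muleC.
rewrite -{1}(setUv B) ge0_integral_setU//; last first.
- by rewrite disj_set2E setICr.
- by move=> w _; rewrite lee_fin mulr_ge0//; case: ifP.
- have := dmeas_comp2 (fun m (z : bool) => (m * (if z then x else y))%:E)
    (others_dmeas mM) (dmeas_bool mB).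
  by rewrite setUv => h; exact: (dmeas_measurable_fun id h).
- exact: measurableC.
rewrite (piece B x)//; last by move=> w; rewrite /B /= => ->.
rewrite (piece (~` B) y)//; last 2 first.
- exact: measurableC.
- by move=> w; rewrite /B /= => /negP/negbTE ->.
rewrite (integral_indep GB mM M0) (integral_indep (GC GB) mM M0).
rewrite probability_setC// PB -EFinB !muleA -!EFinM -ge0_muleDl.
- by rewrite -EFinD mulrC [(1 - p) * y]mulrC.
- by rewrite lee_fin mulr_ge0// -lee_fin -PB measure_ge0.
- rewrite lee_fin mulr_ge0// subr_ge0 -lee_fin -PB; exact: probability_le1.
Qed.

(** The trial [b] is consulted only when [q] holds. As [q] may be correlated with [M], the averaged
    factor has to stay under the integral; splitting [M] according to [q] reduces to the
    unconditional case. *)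
Lemma integral_peel_if i0 (b q : T -> bool) (p x y : R) (M : T -> R) :
  G i0 [set w | b w] -> P [set w | b w] = p%:E ->
  @dmeas _ (others i0) R M -> @dmeas _ (others i0) bool q ->
  (forall w, 0 <= M w) -> 0 <= x -> 0 <= y ->
  (\int[P]_w (M w * (if q w then (if b w then x else y) else 1))%:E =
   \int[P]_w (M w * (if q w then p * x + (1 - p) * y else 1))%:E)%E.
Proof.
move=> GB PB mM mq M0 x0 y0.
have mB : measurable [set w | b w] := mG GB.
have mM' := others_dmeas mM; have mq' := others_dmeas mq.
have p01 : 0 <= p <= 1.
  by rewrite -!lee_fin -PB measure_ge0 probability_le1.
have z0 : 0 <= p * x + (1 - p) * y.
  by move: p01 => /andP[? ?]; rewrite addr_ge0// mulr_ge0// subr_ge0.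
pose Mq w := M w * (q w)%:R; pose Mn w := M w * (~~ q w)%:R.
have mMq : @dmeas _ (others i0) R Mq.
  exact: (dmeas_comp2 (fun m (z : bool) => m * z%:R) mM mq).
have Mq0 w : 0 <= Mq w by rewrite mulr_ge0.
have Mn0 w : 0 <= Mn w by rewrite mulr_ge0.
have mMn : dmeas Mn.
  exact: (dmeas_comp2 (fun m (z : bool) => m * (~~ z)%:R) mM' mq').
transitivity (\int[P]_w ((Mq w * (if b w then x else y))%:E + (Mn w)%:E))%E.
  apply: eq_integral => w _; rewrite -EFinD /Mq /Mn; congr EFin.
  by case: (q w) => /=; rewrite ?mulr1 ?mulr0 ?mul0r ?addr0 ?add0r.
rewrite ge0_integralD//; last 4 first.
- by move=> w _; rewrite lee_fin mulr_ge0//; case: ifP.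
- have := dmeas_comp2 (fun m (z : bool) => (m * (if z then x else y)))
    (others_dmeas mMq) (dmeas_bool mB).
  exact: (dmeas_measurable_fun (@EFin R)).
- by move=> w _; rewrite lee_fin.
- exact: (dmeas_measurable_fun (@EFin R) mMn).
rewrite (integral_peel GB PB mMq Mq0 x0 y0) -ge0_integralZl//; last 2 first.
- exact: (dmeas_measurable_fun (@EFin R) (others_dmeas mMq)).
- by move=> w _; rewrite lee_fin.
rewrite -ge0_integralD//; last 4 first.
- by move=> w _; rewrite -EFinM lee_fin mulr_ge0.
- have := dmeas_comp ( *%R (p * x + (1 - p) * y)) (others_dmeas mMq).
  exact: (dmeas_measurable_fun (@EFin R)).
- by move=> w _; rewrite lee_fin.
- exact: (dmeas_measurable_fun (@EFin R) mMn).
apply: eq_integral => w _; rewrite -EFinM -EFinD /Mq /Mn; congr EFin.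
by case: (q w) => /=; ring.
Qed.

End Independence.

(** * Tails of the Beta distribution *)

Section BetaTail.
Variable R : realType.

(** The Chernoff bound for a binomial weight: after tilting by [exp th], the term of index [a] is
    one nonnegative summand of the expansion of [((1 - y) + y * expR th) ^+ (a + b)]. *)
Lemma binomial_term_le (a b : nat) (y th : R) : 0 <= y <= 1 ->
  ('C(a + b, a))%:R * (y ^+ a * (1 - y) ^+ b) <=
  expR (- (th * a%:R)) * (1 + y * (expR th - 1)) ^+ (a + b).
Proof.
move=> /andP[y0 y1].
have -> : 1 + y * (expR th - 1) = (1 - y) + y * expR th by ring.
rewrite [X in _ <= _ * X]exprDn.
have ab : (a < (a + b).+1)%N by rewrite ltnS leq_addr.
rewrite (bigD1 (Ordinal ab))//= addKn mulrDr.
apply: ler_wpDr.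
  rewrite mulr_ge0 ?expR_ge0// sumr_ge0// => i _.
  by rewrite mulrn_wge0// mulr_ge0// exprn_ge0 ?subr_ge0// mulr_ge0// expR_ge0.
rewrite exprMn -expRM_natr -mulr_natl.
rewrite (_ : expR _ * _ = ('C(a + b, a))%:R * (y ^+ a * (1 - y) ^+ b) *
   (expR (- (th * a%:R)) * expR (th * a%:R))); last by ring.
by rewrite -expRD addNr expR0; lra.
Qed.

(** With integer parameters the density is [a + b + 1] times the probability of [a] successes in
    [a + b] trials of parameter [y], so a concentration bound for the binomial law bounds it
    pointwise. *)
Lemma beta_pdf_le (a b : nat) (y th : R) : 0 <= y <= 1 -> th <= 2^-1 ->
  beta_pdf a.+1 b.+1 y <=
  (a + b).+1%:R * expR ((a + b)%:R * (th * (y - a%:R / (a + b)%:R) + th ^+ 2)).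
Proof.
move=> y01 th1; have /andP[y0 y1] := y01.
rewrite /beta_pdf patchE mem_set/=; last by rewrite in_itv/=.
rewrite beta_fun_fact -[XMonemX _ _ _]/(y ^+ a * (1 - y) ^+ b).
have -> : y ^+ a * (1 - y) ^+ b / ((a`! * b`!)%:R / ((a + b).+1)`!%:R) =
  (a + b).+1%:R * (('C(a + b, a))%:R * (y ^+ a * (1 - y) ^+ b)).
  have := bin_fact (leq_addr b a); rewrite addKn => bf.
  have nz : ((a`! * b`!)%:R : R) != 0.
    by rewrite pnatr_eq0 muln_eq0 negb_or -!lt0n !fact_gt0.
  rewrite invf_div factS -bf !natrM; move: nz; rewrite natrM; move: (a`!%:R : R) (b`!%:R : R) => A B nz.
  by field; move: nz; rewrite mulf_eq0 negb_or => /andP[-> ->].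
rewrite ler_pM2l ?ltr0n//; apply: (le_trans (binomial_term_le a b th y01)).
have h : (1 + y * (expR th - 1)) ^+ (a + b) <= expR (y * (th + th ^+ 2)) ^+ (a + b).
  apply: lerXn2r; rewrite ?nnegrE ?expR_ge0 ?bernoulli_mgf_le//.
  have := expR_gt0 th; nra.
apply: (le_trans (ler_wpM2l (expR_ge0 _) h)).
rewrite -expRM_natl -expRD ler_expR.
(* With no observations the quotient is [0 / 0 = 0], and the identity still holds because
   [a = 0]. *)
have e : (a + b)%:R * (a%:R / (a + b)%:R) = a%:R :> R.
  have [/eqP|ab] := eqVneq (a + b)%N 0%N.
    by rewrite addn_eq0 => /andP[/eqP -> /eqP ->]; rewrite mul0r.
  by rewrite mulrCA divff ?mulr1// pnatr_eq0.
have n0 : 0 <= (a + b)%:R :> R by [].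
have t2 : 0 <= th ^+ 2 by exact: sqr_ge0.
set p := (a%:R / (a + b)%:R) in e *; rewrite -e.
move: p ((a + b)%:R : R) n0 {e h} => p n n0.
have : 0 <= n * th ^+ 2 * (1 - y) by apply: mulr_ge0; [exact: mulr_ge0|rewrite subr_ge0].
lra.
Qed.

Lemma measurable_deviation (c dl : R) : measurable [set y : R | dl <= `|y - c|].
Proof.
have mf : measurable_fun setT (fun y : R => `|y - c|).
  by apply: measurableT_comp => //; exact: measurable_funB.
rewrite (_ : [set _ | _] = (fun y : R => `|y - c|) @^-1` `[dl, +oo[).
  by rewrite -[X in measurable X]setTI; exact: mf.
by apply/seteqP; split=> y /=; rewrite in_itv/= andbT.
Qed.

(** The centre is the empirical frequency, which is the mode of the law and not its mean.
    Integrating the pointwise bound over the unit interval costs no further factor. *)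
Lemma beta_tail (a b : nat) (dl : R) : 0 < dl <= 1 ->
  (beta_prob a.+1 b.+1 [set y : R | (dl <= `|y - a%:R / (a + b)%:R|)%R] <=
   ((a + b).+1%:R * expR (- ((a + b)%:R * (dl ^+ 2 / 4))))%:E)%E.
Proof.
move=> /andP[d0 d1]; set U := [set _ | _]; set c := (_ * expR _).
have c0 : 0 <= c by rewrite mulr_ge0// expR_ge0.
have mU : measurable U by exact: measurable_deviation.
rewrite -integral_beta_pdf//.
have pw y : U y -> beta_pdf a.+1 b.+1 y <= c * \1_`[0, 1] y.
  move=> Uy; rewrite indicE; have [y01|y01] := boolP (y \in `[0, 1]%classic); last first.
    by rewrite /beta_pdf patchE (negbTE y01) mul0r mulr0.
  rewrite mulr1; move: y01; rewrite inE/= in_itv/= => y01.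
  (* The tilt [dl / 2], with sign opposite to the deviation, minimizes [- th * dl + th ^+ 2] and
     yields [- dl ^+ 2 / 4]. *)
  have [yp|yp] := leP 0 (y - a%:R / (a + b)%:R).
    apply: (le_trans (@beta_pdf_le a b y (- dl / 2) y01 _)); first by lra.
    rewrite /c ler_wpM2l// ler_expR -[leRHS]mulrN ler_wpM2l//.
    by move: Uy; rewrite /U /= ger0_norm// => Uy; nra.
  apply: (le_trans (@beta_pdf_le a b y (dl / 2) y01 _)); first by lra.
  rewrite /c ler_wpM2l// ler_expR -[leRHS]mulrN ler_wpM2l//.
  by move: Uy; rewrite /U /= ltr0_norm// => Uy; nra.
have mpdf := @measurable_beta_pdf R a.+1 b.+1.
apply: (@le_trans _ _ (\int[lebesgue_measure]_(y in U) (c%:E * (\1_`[0, 1] y)%:E))%E).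
  apply: ge0_le_integral => //.
  - by move=> y _; rewrite lee_fin beta_pdf_ge0.
  - by apply/measurable_funTS/measurable_EFinP.
  - apply: measurable_funTS; apply: measurable_funeM; apply/measurable_EFinP.
    exact: measurable_indic.
rewrite ge0_integralZl//; last first.
- by apply/measurable_EFinP; exact: measurable_indic.
rewrite integral_indic// -[leRHS]mule1 lee_pmul//.
apply: (@le_trans _ _ (lebesgue_measure (`[0%R, 1%R]%classic : set R))).
  by apply: le_measure; rewrite ?inE//=; exact: measurableI.
by rewrite lebesgue_measure_itv/= lte_fin ltr01 oppr0 adde0.
Qed.

End BetaTail.

(** * Queue paths *)

Section QueuePaths.
Variables (T : Type) (Q0 : T -> nat) (A S Sg : nat -> T -> bool) (w : T).
Local Notation Q := (fun s => queue Q0 A S s w).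
Local Notation Qg := (fun s => queue Q0 A Sg s w).

(** Time 0 stands in when the queue has never been empty; there the two queues agree, so
    [Q j <= Qg j] holds in either case. *)
Lemma queue_last_empty t : exists2 j, (j <= t)%N &
  (j = 0%N \/ Q j = 0%N) /\ forall s, (j < s <= t)%N -> (0 < Q s)%N.
Proof.
elim: t => [|t [j jt [j0 jP]]]; first by exists 0%N => //; split; [left|lia].
have [q0|q0] := eqVneq (Q t.+1) 0%N.
  by exists t.+1 => //; split; [right|lia].
exists j; first by lia.
split=> // s /andP[js]; rewrite leq_eqVlt => /orP[/eqP ->|st]; first by rewrite lt0n.
by apply: jP; rewrite js.
Qed.

(** A positive queue length shows that the subtraction was not truncated, so the balance of arrivals
    and services is exact. *)
Lemma queue_busy j t : (j <= t)%N -> (forall s, (j < s <= t)%N -> (0 < Q s)%N) ->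
  (Q t + \sum_(j.+1 <= s < t.+1) S s w = Q j + \sum_(j.+1 <= s < t.+1) A s w)%N.
Proof.
elim: t => [|t IH].
  by rewrite leqn0 => /eqP -> _; rewrite !big_geq.
rewrite leq_eqVlt => /orP[/eqP -> _|jt h]; first by rewrite !big_geq.
have {}IH := IH jt; have : forall s, (j < s <= t)%N -> (0 < Q s)%N.
  by move=> s /andP[js st]; apply: h; rewrite js ltnW.
move=> /IH {}IH; have := h t.+1; rewrite jt leqnn => /(_ isT) /=.
rewrite !(@big_nat_recr _ _ _ t.+1)//=.
by case: (A t.+1 w) (S t.+1 w) => -[]; move: IH; lia.
Qed.

(** Truncation at 0 can only lengthen a queue. *)
Lemma queue_ge j t : (j <= t)%N ->
  (Qg j + \sum_(j.+1 <= s < t.+1) A s w <= Qg t + \sum_(j.+1 <= s < t.+1) Sg s w)%N.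
Proof.
elim: t => [|t IH].
  by rewrite leqn0 => /eqP ->; rewrite !big_geq.
rewrite leq_eqVlt => /orP[/eqP ->|jt]; first by rewrite !big_geq.
have {}IH := IH jt; rewrite !(@big_nat_recr _ _ _ t.+1)//=.
by case: (A t.+1 w) (Sg t.+1 w) => -[]; move: IH; lia.
Qed.

Variable m : nat -> bool.
Hypothesis Sm : forall s, (0 < s)%N -> (Sg s w <= S s w + m s)%N.

Lemma sum_service_le j t : (\sum_(j.+1 <= s < t.+1) Sg s w <=
  \sum_(j.+1 <= s < t.+1) S s w + \sum_(j.+1 <= s < t.+1) m s)%N.
Proof.
rewrite -big_split /= !big_nat; apply: leq_sum => s /andP[js _]; apply: Sm.
exact: leq_ltn_trans js.
Qed.

(** A crude bound, applied on the rare events where nothing better is known. *)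
Lemma queue_regret_le t : (Q t <= Qg t + t)%N.
Proof.
have [j jt [j0 jP]] := queue_last_empty t.
have := queue_busy jt jP; have := queue_ge jt; have := sum_service_le j t.
have : (Q j <= Qg j)%N by case: j0 => [->|->].
have : (\sum_(j.+1 <= s < t.+1) m s <= t)%N.
  apply: (@leq_trans (\sum_(j.+1 <= s < t.+1) 1)).
    by apply: leq_sum => s _; case: (m s).
  by rewrite sum_nat_const_nat muln1; lia.
lia.
Qed.

(* [e] marks the slots in which the queue may lack its best server *)
Lemma queue_regret_window (e : nat -> bool) t N :
  (forall s, (0 < s <= t)%N -> (m s <= e s)%N) ->
  (Q t <= Qg t + \sum_((t - N).+1 <= s < t.+1) e s)%N \/
  exists2 j, (j < t - N)%N &
   (\sum_(j.+1 <= s < t.+1) Sg s w <= (j == 0%N) * Q0 w +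
     \sum_(j.+1 <= s < t.+1) A s w + \sum_(j.+1 <= s < t.+1) e s)%N.
Proof.
move=> me; have [j jt [j0 jP]] := queue_last_empty t.
have hb := queue_busy jt jP; have hg := queue_ge jt; have hs := sum_service_le j t.
have hQ : (Q j <= Qg j)%N by case: j0 => [->|->].
have hm : (\sum_(j.+1 <= s < t.+1) m s <= \sum_(j.+1 <= s < t.+1) e s)%N.
  rewrite !big_nat; apply: leq_sum => s /andP[js st]; apply: me.
  by move: js st; lia.
have [jN|jN] := ltnP j (t - N); last first.
  left; have : (\sum_(j.+1 <= s < t.+1) e s <= \sum_((t - N).+1 <= s < t.+1) e s)%N.
    rewrite (@big_cat_nat _ _ _ j.+1 (t - N).+1)//=.
    by rewrite leq_addl.
  lia.
right; exists j => //.
have : (Q j <= (j == 0%N) * Q0 w)%N.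
  by case: j0 => [->|->]//=; rewrite mul1n.
lia.
Qed.

End QueuePaths.

Lemma sum_early_le W j t : (\sum_(j.+1 <= s < t.+1) (s <= W) <= W - j)%N.
Proof.
elim: t => [|t IH]; first by rewrite big_geq.
have [jt|jt] := leqP j t; last by rewrite big_geq.
rewrite big_nat_recr//=; case: (leqP t.+1 W) => tW; last by rewrite addn0.
suff : (\sum_(j.+1 <= s < t.+1) (s <= W) <= t - j)%N by lia.
apply: (@leq_trans (\sum_(j.+1 <= s < t.+1) 1)).
  by apply: leq_sum => s _; case: (s <= W)%N.
by rewrite sum_nat_const_nat muln1; lia.
Qed.

(** * Preferred servers and minimal-mismatch matchings *)

Section Selection.
Variables (R : realType) (U K : nat).

(** If the preferred servers already form a matching, mismatch 0 is attainable, and a minimizer must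
    attain it. *)
Lemma selector_matching (sel : nat -> ('I_U -> option 'I_K) -> 'I_U -> option 'I_K) t kh :
  min_mismatch_selector sel -> is_matching kh -> forall u, sel t kh u = kh u.
Proof.
move=> hsel hkh u; have [_ /(_ kh hkh)] := hsel t kh.
have -> : mismatch kh kh = 0%N by rewrite /mismatch big1// => v _; rewrite eqxx.
by rewrite leqn0 sum_nat_eq0 => /forallP/(_ u)/=; rewrite eqb0 negbK => /eqP.
Qed.

Lemma khat_argmax (T : Type) (Theta : 'I_U -> 'I_K -> nat -> nat -> nat -> T -> R)
    t (c : counts U K) w u k :
  (forall k', k' != k -> Theta u k' t (c.1 u k').+1 (c.2 u k').+1 w <
     Theta u k t (c.1 u k).+1 (c.2 u k).+1 w) ->
  khat Theta t c w u = Some k.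
Proof.
move=> h; rewrite /khat; case: pickP => [k0 /forallP/(_ k)|/(_ k)].
  by have [->//|/h] := eqVneq k0 k; rewrite ltNge => /negbTE ->.
move=> /forallP []; move=> k'; have [->//|/h/ltW//] := eqVneq k' k.
Qed.

End Selection.

(** * Measurability of the algorithm *)

Section AlgorithmMeasurability.
Context (R : realType) (U K : nat) (d : measure_display) (T : measurableType d).
Variable Ecal : 'I_K -> 'I_U -> option 'I_K.
Variable sel : nat -> ('I_U -> option 'I_K) -> ('I_U -> option 'I_K).
Variable Srv : 'I_U -> 'I_K -> nat -> T -> bool.
Variable Coin : nat -> T -> bool.
Variable Pick : nat -> T -> 'I_K.
Variable Theta : 'I_U -> 'I_K -> nat -> nat -> nat -> T -> R.
Local Notation hist := (hist Ecal sel Srv Coin Pick Theta).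
Local Notation sched_of := (sched_of Ecal sel Coin Pick Theta).

(** The Beta draws are not countably valued, but for fixed counts the choice depends on them only
    through finitely many pairwise comparisons. *)
Lemma dmeas_khat t (c : counts U K) :
  (forall u k a b, measurable_fun setT (Theta u k t a b)) ->
  dmeas (khat Theta t c).
Proof.
move=> mT.
pose b (p : 'I_U * 'I_K * 'I_K) w :=
  Theta p.1.1 p.1.2 t (c.1 p.1.1 p.1.2).+1 (c.2 p.1.1 p.1.2).+1 w <=
  Theta p.1.1 p.2 t (c.1 p.1.1 p.2).+1 (c.2 p.1.1 p.2).+1 w.
have mb p : dmeas (b p).
  apply: dmeas_bool.
  have := @measurable_fun_ler _ T R setT _ _ (mT p.1.1 p.1.2 (c.1 p.1.1 p.1.2).+1
     (c.2 p.1.1 p.1.2).+1) (mT p.1.1 p.2 (c.1 p.1.1 p.2).+1 (c.2 p.1.1 p.2).+1).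
  move=> /(_ measurableT [set true]); rewrite setTI; apply.
  by [].
exact: (dmeas_comp (fun (f : 'I_U * 'I_K * 'I_K -> bool) (u : 'I_U) =>
  [pick k : 'I_K | [forall k' : 'I_K, f (u, k', k)]]) (dmeas_family mb)).
Qed.

(** Restricted to the slots [1..t] so that it can be instantiated with the sigma-algebra of all
    variables other than a service of slot [t + 1]. *)
Definition past_measurable (t : nat) : Prop :=
  forall s, (0 < s <= t)%N ->
  [/\ measurable [set w | Coin s w], forall i, measurable [set w | Pick s w = i],
   forall u k, measurable [set w | Srv u k s w] &
   forall u k a b, measurable_fun setT (Theta u k s a b)].

Lemma dmeas_sched_of t (X : T -> counts U K) :
  measurable [set w | Coin t w] -> (forall i, measurable [set w | Pick t w = i]) ->
  (forall u k a b, measurable_fun setT (Theta u k t a b)) ->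
  dmeas X -> dmeas (fun w => sched_of t (X w) w).
Proof.
move=> mC mP mT mX; apply: (@dmeas_bind _ _ _ _ X (sched_of t)) => // c.
have h1 := dmeas_pair (dmeas_pair (dmeas_bool mC) (dmeas_count mP)) (dmeas_khat c mT).
exact: (dmeas_comp (fun p : bool * 'I_K * ('I_U -> option 'I_K) =>
  if p.1.1 then Ecal p.1.2 else sel t p.2) h1).
Qed.

Lemma dmeas_hist t : past_measurable t -> dmeas (hist t).
Proof.
elim: t => [_|t IH mt]; first exact: dmeas_cst.
have mh : dmeas (hist t).
  by apply: IH => s /andP[s0 st]; apply: mt; rewrite s0 ltnW.
have [mC mP mS mT] := mt t.+1 (leqnn _).
have mm := dmeas_sched_of mC mP mT mh.
have mSf : dmeas (fun w (p : 'I_U * 'I_K) => Srv p.1 p.2 t.+1 w).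
  by apply: dmeas_family => p; exact: dmeas_bool.
exact: (dmeas_comp (fun p : (counts U K * ('I_U -> option 'I_K)) *
    ('I_U * 'I_K -> bool) =>
  ((fun u k => (p.1.1.1 u k + ((p.1.2 u == Some k) && p.2 (u, k)))%N),
   (fun u k => (p.1.1.2 u k + ((p.1.2 u == Some k) && ~~ p.2 (u, k)))%N)))
  (dmeas_pair (dmeas_pair mh mm) mSf)).
Qed.

End AlgorithmMeasurability.

Lemma dmeas_queue d (T : measurableType d) (Q0 : T -> nat) (A S : nat -> T -> bool) t :
  dmeas Q0 -> (forall s, (0 < s <= t)%N -> dmeas (A s) /\ dmeas (S s)) ->
  dmeas (queue Q0 A S t).
Proof.
move=> mQ; elim: t => [//|t IH] mAS.
have {}IH : dmeas (queue Q0 A S t).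
  by apply: IH => s /andP[s0 st]; apply: mAS; rewrite s0 ltnW.
have [mA mS] := mAS t.+1 (leqnn _).
exact: (dmeas_comp (fun p : nat * bool * bool => (p.1.1 + p.1.2 - p.2)%N)
  (dmeas_pair (dmeas_pair IH mA) mS)).
Qed.

(** * Markov and union bounds *)

Section ProbabilityBounds.
Context (R : realType) (d : measure_display) (T : measurableType d).
Variable P : probability T R.

Lemma markov_bound (A : set T) (f : T -> R) (b : R) : measurable A -> dmeas f ->
  (forall w, 0 <= f w) -> (forall w, A w -> 1 <= f w) ->
  (\int[P]_w (f w)%:E <= b%:E -> P A <= b%:E)%E.
Proof.
move=> mA mf f0 Af; apply: le_trans.
rewrite -[A in P A]setIT -integral_indic//.
apply: ge0_le_integral => //.
- by apply/measurable_EFinP; exact: measurable_indic.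
- exact: (dmeas_measurable_fun (@EFin R) mf).
- move=> w _; rewrite lee_fin indicE; have [wA|wA] := boolP (w \in A) => //.
  by apply: Af; rewrite inE in wA.
Qed.

Lemma prob_exists_le (I : finType) (A : I -> set T) (b : I -> R) :
  (forall i, measurable (A i)) -> (forall i, (P (A i) <= (b i)%:E)%E) ->
  (P [set w | exists i, A i w] <= (\sum_i b i)%:E)%E.
Proof.
move=> mA Pb.
have -> : [set w | exists i, A i w] = \big[setU/set0]_(i <- enum I) A i.
  rewrite -bigcup_seq; apply/seteqP; split=> w /=.
    by move=> [i Aw]; exists i => //; rewrite /= mem_enum.
  by move=> [i _ Aw]; exists i.
rewrite -big_enum/=; elim: (enum I) => [|i s IH].
  by rewrite !big_nil measure0.
rewrite !big_cons EFinD; apply: le_trans (leeD (Pb i) IH).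
by apply: measureU2 => //; apply: bigsetU_measurable.
Qed.

Lemma prob_le_exists (B : set T) (I : finType) (A : I -> set T) (b : I -> R) :
  measurable B -> (forall i, measurable (A i)) ->
  (forall i, (P (A i) <= (b i)%:E)%E) ->
  (forall w, B w -> exists i, A i w) -> (P B <= (\sum_i b i)%:E)%E.
Proof.
move=> mB mA Pb BA; apply: le_trans (prob_exists_le mA Pb).
apply: le_measure; rewrite ?inE//.
rewrite (_ : [set _ | _] = \bigcup_(i in [set: I]) A i).
  exact: fin_bigcup_measurable.
by apply/seteqP; split=> w /= [i]; [move=> ?; exists i|move=> _ ?; exists i].
Qed.

End ProbabilityBounds.

(** * The stationary queue *)

Section Stationary.
Variables (R : realType) (lam mu : R) (pi : nat -> R).
Hypotheses (lam0 : 0 <= lam) (lam_mu : lam < mu) (mu1 : mu <= 1).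
Hypothesis stat : is_stationary lam mu pi.

(** An arrival and a service in the same slot cancel; truncation at the empty state is the
    convention [0.-1 = 0]. *)
Lemma genie_transE m n : genie_trans lam mu m n =
  lam * mu * ((m == n)%:R) + lam * (1 - mu) * ((m.+1 == n)%:R) +
  (1 - lam) * mu * ((m.-1 == n)%:R) + (1 - lam) * (1 - mu) * ((m == n)%:R).
Proof.
rewrite /genie_trans !big_bool /bern_w /= addn0 subn0 !addn1 !subn1 /= subn0.
ring.
Qed.

Lemma stationary_eq n : pi n = \sum_(0 <= m < n.+2) pi m * genie_trans lam mu m n.
Proof.
have [pi0 [_ h]] := stat; apply: EFin_inj; rewrite {1}h.
have t0 m : 0 <= genie_trans lam mu m n.
  have h1 : 0 <= lam * mu by apply: mulr_ge0; move: lam0 lam_mu mu1; lra.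
  have h2 : 0 <= lam * (1 - mu) by apply: mulr_ge0; move: lam0 lam_mu mu1; lra.
  have h3 : 0 <= (1 - lam) * mu by apply: mulr_ge0; move: lam0 lam_mu mu1; lra.
  have h4 : 0 <= (1 - lam) * (1 - mu) by apply: mulr_ge0; move: lam0 lam_mu mu1; lra.
  by rewrite genie_transE; do 3 (apply: addr_ge0; last exact: mulr_ge0); exact: mulr_ge0.
rewrite (nneseries_split _ n.+2); last by move=> m _; rewrite lee_fin mulr_ge0.
rewrite eseries0 ?adde0 ?add0n ?sumEFin//.
move=> m /= mn _; rewrite genie_transE.
have /negbTE -> : (m != n) by lia.
have /negbTE -> : (m.+1 != n) by lia.
have /negbTE -> : (m.-1 != n) by lia.
by rewrite !mulr0 !addr0 mulr0.
Qed.

(** The chain moves by at most one step, so it is a birth-death chain: the stationarity equation at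
    [n + 1] combined with balance across the previous edge gives balance across the next one. *)
Lemma detailed_balance n : pi n * (lam * (1 - mu)) = pi n.+1 * ((1 - lam) * mu).
Proof.
elim: n => [|n IH].
  have := stationary_eq 0; rewrite !big_nat_recr//= big_geq// !genie_transE /=.
  rewrite !mulr1 !mulr0 !addr0 !add0r => h.
  by apply/eqP; rewrite -subr_eq0; apply/eqP; move: h; lra.
have := stationary_eq n.+1; rewrite !big_nat_recr//= big1_seq ?add0r; last first.
  move=> m; rewrite mem_index_iota => /andP[_ mn]; rewrite genie_transE.
  have /negbTE -> : (m != n.+1) by lia.
  have /negbTE -> : (m.+1 != n.+1) by lia.
  have /negbTE -> : (m.-1 != n.+1) by lia.
  by rewrite !mulr0 !addr0 mulr0.
rewrite !genie_transE /= !eqxx.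
have /negbTE -> : (n != n.+1) by lia.
have /negbTE -> : (n.+2 != n.+1) by lia.
have /negbTE -> : (n.-1 != n.+1) by lia.
have /negbTE -> : (n.+3 != n.+1) by lia.
rewrite !mulr1 !mulr0 !addr0 !add0r; move: IH; lra.
Qed.

(** By detailed balance the ratio is [lam (1 - mu) / ((1 - lam) mu)], that is, 1 minus
    [(mu - lam) / ((1 - lam) mu)], whose denominator is at most 1. *)
Lemma stationary_ratio n : pi n.+1 <= (1 - (mu - lam)) * pi n.
Proof.
have [pi0 _] := stat; have := detailed_balance n; have := pi0 n; have := pi0 n.+1.
have b0 : 0 < (1 - lam) * mu by apply: mulr_gt0; move: lam0 lam_mu mu1; lra.
move=> h1 h2 h3; rewrite -(ler_pM2r b0) -h3 (mulrC (1 - _)) -mulrA.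
apply: ler_wpM2l => //.
have b1 : (1 - lam) * mu <= 1 by move: lam0 lam_mu mu1; nra.
have : (mu - lam) * ((1 - lam) * mu) <= (mu - lam) * 1.
  by rewrite ler_wpM2l// subr_ge0 ltW.
lra.
Qed.

Lemma stationary_tail (d : measure_display) (T : measurableType d) (P : probability T R)
    (Q0 : T -> nat) q : (forall n, measurable [set w | Q0 w = n]) ->
  (forall n, P [set w | Q0 w = n] = (pi n)%:E) ->
  (P [set w | (q <= Q0 w)%N] <= ((1 - (mu - lam)) ^+ q)%:E)%E.
Proof.
move=> mQ PQ; have [pi0 [pi1 _]] := stat.
have r0 : 0 <= 1 - (mu - lam) by move: lam0 lam_mu mu1; lra.
have mQ0 := dmeas_count mQ.
elim: q => [|q IH].
  rewrite expr0; apply: probability_le1.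
  exact: (dmeas_preimage [set n | (0 <= n)%N] mQ0).
have E k : P [set w | (k <= Q0 w)%N] = (\sum_(n <oo) (pi (n + k)%N)%:E)%E.
  rewrite (_ : [set _ | _] = \bigcup_n [set w | Q0 w = (n + k)%N]); last first.
    apply/seteqP; split=> w /=.
      by move=> kw; exists (Q0 w - k)%N => //=; rewrite subnK.
    by move=> [n _ /= ->]; rewrite leq_addl.
  rewrite measure_semi_bigcup//; last exact: bigcupT_measurable.
    by apply: eq_eseriesr => n _; exact: PQ.
  apply/trivIsetP => i j _ _ ij; apply/seteqP; split=> // w [/= -> /eqP].
  by rewrite eqn_add2r (negbTE ij).
move: IH; rewrite !E => IH; rewrite exprS EFinM.
apply: (@le_trans _ _ ((1 - (mu - lam))%:E * \sum_(n <oo) (pi (n + q)%N)%:E)%E); last first.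
  by rewrite lee_wpmul2l// lee_fin.
rewrite -nneseriesZl; last by move=> n _; rewrite lee_fin.
apply: lee_nneseries => [n _|n _]; rewrite ?lee_fin//.
by rewrite addnS; exact: stationary_ratio.
Qed.

End Stationary.

(** * Probabilistic estimates *)

Lemma explore_prob01 (R : realType) (K t : nat) : 0 <= explore_prob R K t <= 1.
Proof.
rewrite /explore_prob le_min ge_min lexx ler01 /= andbT.
by rewrite divr_ge0// mulr_ge0// ?sqr_ge0// mulr_ge0.
Qed.

Section Model.
Context (R : realType) (U K : nat) (lam : 'I_U -> R) (mu : 'I_U -> 'I_K -> R).
Variable Ecal : 'I_K -> 'I_U -> option 'I_K.
Variable sel : nat -> ('I_U -> option 'I_K) -> ('I_U -> option 'I_K).
Context (d : measure_display) (T : measurableType d) (P : probability T R).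
Variables (Arr : 'I_U -> nat -> T -> bool) (Srv : 'I_U -> 'I_K -> nat -> T -> bool).
Variables (Coin : nat -> T -> bool) (Pick : nat -> T -> 'I_K).
Variable Theta : 'I_U -> 'I_K -> nat -> nat -> nat -> T -> R.
Variable Q0 : 'I_U -> T -> nat.
Hypothesis mu01 : forall u k, 0 <= mu u k <= 1.
Hypothesis lam01 : forall u, 0 <= lam u <= 1.
Hypothesis mArr : forall u t, measurable [set w | Arr u t w].
Hypothesis mSrv : forall u k t, measurable [set w | Srv u k t w].
Hypothesis mCoin : forall t, measurable [set w | Coin t w].
Hypothesis mPick : forall t i, measurable [set w | Pick t w = i].
Hypothesis mTheta : forall u k t a b, measurable_fun setT (Theta u k t a b).
Hypothesis mQ0 : forall u n, measurable [set w | Q0 u w = n].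
Hypothesis PArr : forall u t, (1 <= t)%N -> P [set w | Arr u t w] = (lam u)%:E.
Hypothesis PSrv : forall u k t, (1 <= t)%N -> P [set w | Srv u k t w] = (mu u k)%:E.
Hypothesis PCoin : forall t, (1 <= t)%N -> P [set w | Coin t w] = (explore_prob R K t)%:E.
Hypothesis PPick : forall t i, (1 <= t)%N -> P [set w | Pick t w = i] = (K%:R^-1)%:E.
Local Notation G := (prim_events Arr Srv Coin Pick Theta Q0).
Hypothesis indep : mutually_independent P G.
Local Notation hist := (hist Ecal sel Srv Coin Pick Theta).
Local Notation sched_of := (sched_of Ecal sel Coin Pick Theta).
Local Notation p := (explore_prob R K).
Local Notation served := (served Ecal sel Srv Coin Pick Theta).

Definition arr_index u t : prim_index U K := inl (inl (inl (inl (inl (u, t))))).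
Definition srv_index u k t : prim_index U K := inl (inl (inl (inl (inr (u, k, t))))).
Definition coin_index t : prim_index U K := inl (inl (inl (inr t))).
Definition pick_index t : prim_index U K := inl (inl (inr t)).
Definition theta_index u k t a b : prim_index U K := inl (inr (u, k, t, a, b)).

Lemma prim_events_measurable i A : G i A -> measurable A.
Proof.
case: i => [[[[[[u t]|[[u k] t]]|t]|t]|[[[[u k] t] a] b]]|u] /=.
- by move=> [B ->]; apply: dmeas_preimage; exact: dmeas_bool.
- by move=> [B ->]; apply: dmeas_preimage; exact: dmeas_bool.
- by move=> [B ->]; apply: dmeas_preimage; exact: dmeas_bool.
- by move=> [B ->]; apply: dmeas_preimage; exact: dmeas_count.
- by move=> [B mB ->]; rewrite -[X in measurable X]setTI; exact: mTheta.
- by move=> [B ->]; apply: dmeas_preimage; exact: dmeas_count.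
Qed.

Lemma prim_events_setI i : setI_closed (G i).
Proof.
move=> A A'; case: i => [[[[[[u t]|[[u k] t]]|t]|t]|[[[[u k] t] a] b]]|u] /=;
  try (by move=> [B ->] [B' ->]; exists (B `&` B'); rewrite preimage_setI).
by move=> [B mB ->] [B' mB' ->]; exists (B `&` B'); [exact: measurableI|rewrite preimage_setI].
Qed.

Lemma prim_events_setC i A : G i A -> G i (~` A).
Proof.
case: i => [[[[[[u t]|[[u k] t]]|t]|t]|[[[[u k] t] a] b]]|u] /=;
  try (by move=> [B ->]; exists (~` B); rewrite preimage_setC).
by move=> [B mB ->]; exists (~` B); [exact: measurableC|rewrite preimage_setC].
Qed.

Lemma prim_events_setT i : G i setT.
Proof.
case: i => [[[[[[u t]|[[u k] t]]|t]|t]|[[[[u k] t] a] b]]|u] /=;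
  try (by exists setT; rewrite preimage_setT).
by exists setT => //; rewrite preimage_setT.
Qed.

Local Notation O i := (others G i).
Lemma others_arr i u t : arr_index u t != i -> @measurable _ (O i) [set w | Arr u t w].
Proof. by move=> h; apply: (others_gen prim_events_setT h); exists [set true]. Qed.
Lemma others_srv i u k t : srv_index u k t != i -> @measurable _ (O i) [set w | Srv u k t w].
Proof. by move=> h; apply: (others_gen prim_events_setT h); exists [set true]. Qed.
Lemma others_coin i t : coin_index t != i -> @measurable _ (O i) [set w | Coin t w].
Proof. by move=> h; apply: (others_gen prim_events_setT h); exists [set true]. Qed.
Lemma others_pick i t j : pick_index t != i -> @measurable _ (O i) [set w | Pick t w = j].
Proof. by move=> h; apply: (others_gen prim_events_setT h); exists [set j]. Qed.
Lemma others_theta i u k t a b : theta_index u k t a b != i ->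
  @measurable_fun _ _ (O i) R setT (Theta u k t a b).
Proof.
move=> h _ B mB; rewrite setTI; apply: (others_gen prim_events_setT h); by exists B.
Qed.

Definition prim_peel := integral_peel prim_events_measurable prim_events_setI prim_events_setC
  prim_events_setT indep.
Definition prim_peel_if := integral_peel_if prim_events_measurable prim_events_setI
  prim_events_setC prim_events_setT indep.

(** * Accuracy of the empirical means under adaptive sampling *)

Definition pulls t u k w := ((hist t w).1 u k + (hist t w).2 u k)%N.

Lemma dmeas_hist_all t : dmeas (hist t).
Proof. by apply: dmeas_hist => s _; split. Qed.

Lemma others_hist u k t : @dmeas _ (O (srv_index u k t.+1)) _ (hist t).
Proof.
apply: (@dmeas_hist _ _ _ _ (O (srv_index u k t.+1))) => s /andP[s0 st]; split.
- exact: others_coin.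
- by move=> i; exact: others_pick.
- by move=> u' k'; apply: others_srv; apply/eqP => -[_ _ E]; move: st; rewrite E ltnn.
- by move=> *; exact: others_theta.
Qed.

Lemma others_sched u k t :
  @dmeas _ (O (srv_index u k t.+1)) _ (fun w => sched_of t.+1 (hist t w) w).
Proof.
apply: (@dmeas_sched_of _ _ _ _ (O (srv_index u k t.+1))).
- exact: others_coin.
- by move=> i; exact: others_pick.
- by move=> *; exact: others_theta.
- exact: others_hist.
Qed.

(* A supermartingale although the sampling times depend on the past: the service
   offered in a slot is independent of the decision to use it. *)
Definition estimate_martingale (th : R) u k t w := expR (th * (((hist t w).1 u k)%:R - mu u k * (pulls t u k w)%:R)
  - th ^+ 2 * (pulls t u k w)%:R).

Lemma supermartingale_le1 th u k t : th <= 2^-1 ->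
  (\int[P]_w (estimate_martingale th u k t w)%:E <= 1)%E.
Proof.
move=> th1; elim: t => [|t IH].
  under eq_integral do rewrite /estimate_martingale /pulls /= addn0 !(mulr0n, mulr0, subr0) expR0.
  by rewrite integral_cst// mul1e probability_le1.
apply: le_trans IH.
(* [x] and [y] are the factors gained by an observed success and an observed failure; a slot not
   assigned to the pair contributes 1. *)
pose x := expR (th * (1 - mu u k) - th ^+ 2).
pose y := expR (- (th * mu u k) - th ^+ 2).
pose q w := sched_of t.+1 (hist t w) w u == Some k.
have mM : @dmeas _ (O (srv_index u k t.+1)) _ (estimate_martingale th u k t).
  exact: (dmeas_comp (fun c : counts U K => expR (th * ((c.1 u k)%:R -
    mu u k * (c.1 u k + c.2 u k)%:R) - th ^+ 2 * (c.1 u k + c.2 u k)%:R))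
    (others_hist u k t)).
have mq : @dmeas _ (O (srv_index u k t.+1)) _ q.
  exact: (dmeas_comp (fun m : 'I_U -> option 'I_K => m u == Some k) (others_sched u k t)).
have M0 w : 0 <= estimate_martingale th u k t w by exact: expR_ge0.
have GS : G (srv_index u k t.+1) [set w | Srv u k t.+1 w] by exists [set true].
have := prim_peel_if GS (PSrv u k (ltn0Sn t)) mM mq M0 (expR_ge0 _ : 0 <= x) (expR_ge0 _ : 0 <= y).
rewrite (_ : (\int[P]_w _)%E = \int[P]_w (estimate_martingale th u k t.+1 w)%:E)%E; last first.
  apply: eq_integral => w _; congr EFin; rewrite /estimate_martingale /pulls /=.
  rewrite -/(q w); case: (q w) => /=; last by rewrite !addn0 mulr1.
  case: (Srv u k t.+1 w) => /=; rewrite -expRD ?addn0 ?addn1 !natrD -?natr1;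
    congr expR; ring.
move=> ->; apply: ge0_le_integral => //.
- move=> w _; rewrite lee_fin mulr_ge0//; case: ifP => // _.
  by have /andP[? ?] := mu01 u k; rewrite addr_ge0// mulr_ge0 ?expR_ge0// subr_ge0.
- have := dmeas_comp2 (fun m (z : bool) => m * (if z then mu u k * x + (1 - mu u k) * y else 1))
    (others_dmeas prim_events_measurable mM) (others_dmeas prim_events_measurable mq).
  exact: (dmeas_measurable_fun (@EFin R)).
- exact: (dmeas_measurable_fun (@EFin R) (others_dmeas prim_events_measurable mM)).
- move=> w _; rewrite lee_fin -[leRHS]mulr1 ler_wpM2l//; case: ifP => // _.
  have /andP[m0 m1] := mu01 u k.
  (* The mean factor is at most [exp (- (1 - mu) * th ^+ 2)], hence at most 1: the compensator
     [th ^+ 2] per pull outweighs the second-order term of the moment bound. *)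
  have -> : x = y * expR th by rewrite /x /y -expRD; congr expR; ring.
  have -> : mu u k * (y * expR th) + (1 - mu u k) * y = y * (1 + mu u k * (expR th - 1)).
    by ring.
  apply: (le_trans (ler_wpM2l (expR_ge0 _) (bernoulli_mgf_le m0 th1))).
  rewrite -expRD -expR0 ler_expR.
  have := sqr_ge0 th; nra.
Qed.

(** A single tilt [dl / 2] of each sign serves all pull counts [n >= n0] at once, because on the
    event the exponent is at least [n * dl ^+ 2 / 4]. The random count needs no union bound. *)
Lemma estimate_deviation (dl n0 : R) u k t : 0 < dl <= 1 ->
  (P [set w | ((n0 <= (pulls t u k w)%:R) &&
     (dl * (pulls t u k w)%:R <= `|((hist t w).1 u k)%:R - mu u k * (pulls t u k w)%:R|))%R]
   <= (2 * expR (- (n0 * (dl ^+ 2 / 4))))%:E)%E.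
Proof.
move=> /andP[d0 d1].
have mh := dmeas_hist_all t.
have mM th : dmeas (estimate_martingale th u k t).
  exact: (dmeas_comp (fun c : counts U K => expR (th * ((c.1 u k)%:R -
    mu u k * (c.1 u k + c.2 u k)%:R) - th ^+ 2 * (c.1 u k + c.2 u k)%:R)) mh).
set c := expR (- _).
have c0 : 0 <= c by exact: expR_ge0.
set B := [set w | _].
have mB : measurable B.
  apply: (@dmeas_preimage _ _ _ (hist t) [set h : counts U K |
   (n0 <= (h.1 u k + h.2 u k)%:R) && (dl * (h.1 u k + h.2 u k)%:R <=
     `|(h.1 u k)%:R - mu u k * (h.1 u k + h.2 u k)%:R|)] mh).
pose f w := c * estimate_martingale (dl / 2) u k t w + c * estimate_martingale (- (dl / 2)) u k t w.
apply: (@markov_bound _ _ _ _ _ f) => //.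
- exact: (dmeas_comp2 (fun a b => c * a + c * b) (mM _) (mM _)).
- by move=> w; rewrite addr_ge0// mulr_ge0// expR_ge0.
- move=> w /andP[nT dT]; rewrite /f /estimate_martingale.
  set n := (pulls t u k w)%:R in nT dT *; set X := _ - _ in dT *.
  have e1 (z : R) : 0 <= z -> 1 <= expR z by rewrite -[X in X <= expR _]expR0 ler_expR.
  have n00 : 0 <= n by rewrite /n.
  rewrite /c -!expRD; have [X0|X0] := leP 0 X.
    apply: ler_wpDr; first exact: expR_ge0.
    by apply: e1; move: dT; rewrite ger0_norm// => dT; nra.
  apply: ler_wpDl; first exact: expR_ge0.
  by apply: e1; move: dT; rewrite ltr0_norm// => dT; nra.
rewrite /f; under eq_integral do rewrite EFinD !EFinM.
rewrite ge0_integralD//; last 4 first.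
- by move=> w _; rewrite -EFinM lee_fin mulr_ge0// expR_ge0.
- exact: (dmeas_measurable_fun (fun x => (c * x)%:E) (mM _)).
- by move=> w _; rewrite -EFinM lee_fin mulr_ge0// expR_ge0.
- exact: (dmeas_measurable_fun (fun x => (c * x)%:E) (mM _)).
rewrite !ge0_integralZl//; try exact: (dmeas_measurable_fun (@EFin R) (mM _));
  try (by move=> w _; rewrite lee_fin expR_ge0).
have S1 th : th <= 2^-1 -> (c%:E * \int[P]_w (estimate_martingale th u k t w)%:E <= c%:E)%E.
  by move=> th1; rewrite -[leRHS]mule1 lee_wpmul2l ?lee_fin// supermartingale_le1.
rewrite (_ : 2 * c = c + c); last by ring.
by rewrite EFinD; apply: leeD; apply: S1; lra.
Qed.

(** * Explorations as a source of observations *)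

Definition explored h t i w : nat := \sum_(h.+1 <= r < t.+1) (Coin r w && (Pick r w == i)).

Lemma others_explored i h t j :
  (forall r, (r <= t)%N -> coin_index r != i /\ pick_index r != i) ->
  @dmeas _ (O i) _ (explored h t j).
Proof.
move=> hi; apply: dmeas_big => r; rewrite mem_index_iota ltnS => /andP[_ rt].
have [hC hP] := hi r rt.
exact: (dmeas_comp2 (fun c (x : 'I_K) => nat_of_bool (c && (x == j)))
  (dmeas_bool (others_coin hC)) (dmeas_count (fun x => others_pick x hP))).
Qed.

(** In each slot the matching [i] is explored with probability [p / K]. The pick matters only under
    the coin, so it is integrated out first, conditionally, and the coin after it. *)
Lemma explored_mgf h t i : (h <= t)%N ->
  (\int[P]_w (expR (- (explored h t i w)%:R))%:E <=
   (expR (- \sum_(h.+1 <= r < t.+1) p r / K%:R / 2))%:E)%E.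
Proof.
elim: t => [|t IH].
  rewrite leqn0 => /eqP ->; rewrite big_geq// oppr0 expR0.
  under eq_integral do rewrite /explored big_geq// mulr0n oppr0 expR0.
  by rewrite integral_cst// mul1e probability_le1.
rewrite leq_eqVlt => /orP[/eqP ->|ht].
  rewrite big_geq// oppr0 expR0.
  under eq_integral do rewrite /explored big_geq// mulr0n oppr0 expR0.
  by rewrite integral_cst// mul1e probability_le1.
have {}IH := IH ht.
pose M (w : T) : R := expR (- (explored h t i w)%:R).
have mM j : (forall r, (r <= t)%N -> coin_index r != j /\ pick_index r != j) -> @dmeas _ (O j) _ M.
  move=> hj; exact: (dmeas_comp (fun n : nat => expR (- n%:R) : R) (others_explored _ _ hj)).
have mMP : @dmeas _ (O (pick_index t.+1)) _ M.
  by apply: mM => r rt; split=> //; apply/eqP => -[E]; move: rt; rewrite E ltnn.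
have mMC : @dmeas _ (O (coin_index t.+1)) _ M.
  by apply: mM => r rt; split=> //; apply/eqP => -[E]; move: rt; rewrite E ltnn.
have M0 w : 0 <= M w by exact: expR_ge0.
have eP : [set w | Pick t.+1 w == i] = [set w | Pick t.+1 w = i].
  by apply/seteqP; split=> w /= /eqP.
have GP : G (pick_index t.+1) [set w | Pick t.+1 w == i] by rewrite eP; exists [set i].
have PP : P [set w | Pick t.+1 w == i] = (K%:R^-1)%:E by rewrite eP PPick.
have GC : G (coin_index t.+1) [set w | Coin t.+1 w] by exists [set true].
have mq : @dmeas _ (O (pick_index t.+1)) _ (Coin t.+1) by apply: dmeas_bool; exact: others_coin.
have e0 : 0 <= expR (-1) :> R by exact: expR_ge0.
rewrite (_ : (\int[P]_w _)%E = \int[P]_w (M w * (if Coin t.+1 w then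
    (if Pick t.+1 w == i then expR (-1) else 1) else 1))%:E)%E; last first.
  apply: eq_integral => w _; congr EFin; rewrite /M /explored big_nat_recr//=.
  case: (Coin t.+1 w) => /=; last by rewrite addn0 mulr1.
  by case: (_ == i) => /=; rewrite ?addn0 ?mulr1// natrD opprD expRD.
rewrite (prim_peel_if GP PP mMP mq M0 e0 ler01).
have k0 : 0 <= K%:R^-1 :> R by rewrite invr_ge0.
have k1 : K%:R^-1 <= 1 :> R.
  by have [->|K0] := posnP K; rewrite ?invr0// invf_le1 ?ltr0n// ler1n.
have kp0 : 0 <= K%:R^-1 * expR (-1) + (1 - K%:R^-1) * 1 :> R.
  by rewrite addr_ge0// mulr_ge0// subr_ge0.
rewrite (prim_peel GC (PCoin (ltn0Sn t)) mMC M0 kp0 ler01).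
rewrite big_nat_recr//= opprD expRD EFinM muleC.
have /andP[p0 p1] := explore_prob01 R K t.+1.
apply: lee_pmul => //.
- by apply: integral_ge0 => w _; rewrite lee_fin.
- by rewrite lee_fin addr_ge0// mulr_ge0// subr_ge0.
- rewrite lee_fin.
  have pk : 0 <= p t.+1 / K%:R by rewrite mulr_ge0.
  by apply: le_trans (bernoulli_mgfN pk); rewrite le_eqVlt; apply/orP; left; apply/eqP; ring.
Qed.

Lemma pulls_ge_explored h t u k i w : Ecal i u = Some k ->
  (explored h t i w <= pulls t u k w)%N.
Proof.
move=> Ei; elim: t => [|t IH]; first by rewrite /explored big_geq.
have [ht|ht] := leqP h t; last by rewrite /explored big_geq.
rewrite /explored big_nat_recr//= -/(explored h t i w) /pulls /=.
move: IH; rewrite /pulls; set a := (hist t w).1 u k; set b := (hist t w).2 u k => IH.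
have : (Coin t.+1 w && (Pick t.+1 w == i) <= (sched_of t.+1 (hist t w) w u == Some k))%N.
  case: (boolP (_ && _)) => // /andP[c /eqP pk].
  by rewrite /sched_of c pk Ei eqxx.
by case: (_ == Some k); case: (Srv u k t.+1 w) => /=; lia.
Qed.

Lemma few_pulls (n0 : R) h t u k i : (h <= t)%N -> Ecal i u = Some k ->
  (P [set w | ((pulls t u k w)%:R < n0)%R] <=
   (expR (n0 - \sum_(h.+1 <= r < t.+1) p r / K%:R / 2))%:E)%E.
Proof.
move=> ht Ei.
have mE : dmeas (explored h t i).
  apply: dmeas_big => r _.
  exact: (dmeas_comp2 (fun c (x : 'I_K) => nat_of_bool (c && (x == i)))
    (dmeas_bool (mCoin r)) (dmeas_count (mPick r))).
apply: (@markov_bound _ _ _ _ _ (fun w => expR n0 * expR (- (explored h t i w)%:R) : R)).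
- exact: (@dmeas_preimage _ _ _ (hist t) [set c : counts U K |
    (c.1 u k + c.2 u k)%:R < n0] (dmeas_hist_all t)).
- exact: (dmeas_comp (fun n : nat => expR n0 * expR (- n%:R)) mE).
- by move=> w; rewrite mulr_ge0// expR_ge0.
- move=> w /= nw; rewrite -expRD -[X in X <= _]expR0 ler_expR subr_ge0.
  by apply: le_trans (ltW nw); rewrite ler_nat; exact: pulls_ge_explored.
under eq_integral do rewrite EFinM.
rewrite ge0_integralZl ?lee_fin ?expR_ge0//; last first.
  exact: (dmeas_measurable_fun (fun n : nat => (expR (- n%:R) : R)%:E) mE).
rewrite expRD EFinM lee_wpmul2l ?lee_fin ?expR_ge0//.
exact: explored_mgf.
Qed.

(** Coins are added to the arrivals because each exploration may cost the queue one service of its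
    best server. All three sums are made of primitive variables. *)
Definition net_input (u : 'I_U) (k : 'I_K) j t (w : T) : R :=
  (\sum_(j.+1 <= s < t.+1) Arr u s w)%:R + (\sum_(j.+1 <= s < t.+1) Coin s w)%:R -
  (\sum_(j.+1 <= s < t.+1) Srv u k s w)%:R.

Lemma others_net_input i u k j t :
  (forall s, (s <= t)%N -> [/\ arr_index u s != i, coin_index s != i & srv_index u k s != i]) ->
  @dmeas _ (O i) _ (net_input u k j t).
Proof.
move=> hi.
have mm (X : nat -> T -> bool) :
    (forall s, (s <= t)%N -> @measurable _ (O i) [set w | X s w]) ->
    @dmeas _ (O i) _ (fun w => \sum_(j.+1 <= s < t.+1) X s w)%N.
  move=> mX; apply: dmeas_big => s; rewrite mem_index_iota ltnS => /andP[_ st].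
  exact: (dmeas_comp nat_of_bool (dmeas_bool (mX s st))).
have h1 : @dmeas _ (O i) _ (fun w => \sum_(j.+1 <= s < t.+1) Arr u s w)%N.
  by apply: mm => s st; have [h _ _] := hi s st; exact: others_arr.
have h2 : @dmeas _ (O i) _ (fun w => \sum_(j.+1 <= s < t.+1) Coin s w)%N.
  by apply: mm => s st; have [_ h _] := hi s st; exact: others_coin.
have h3 : @dmeas _ (O i) _ (fun w => \sum_(j.+1 <= s < t.+1) Srv u k s w)%N.
  by apply: mm => s st; have [_ _ h] := hi s st; exact: others_srv.
exact: (dmeas_comp2 (fun (x : R) (n : nat) => x - n%:R)
  (dmeas_comp2 (fun n m : nat => n%:R + m%:R : R) h1 h2) h3).
Qed.

(** With [th = eps / 2], arrival and service together contribute at most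
    [- eps * th + th ^+ 2 = - eps ^+ 2 / 4], as exactly one of them occurs with probability at most
    1. A coin contributes [p * (th + th ^+ 2) <= eps * p], since [th <= 1/2]. *)
Lemma net_input_mgf u k j t : lam u <= mu u k -> (j <= t)%N ->
  (\int[P]_w (expR ((mu u k - lam u) / 2 * net_input u k j t w))%:E <=
   (expR (\sum_(j.+1 <= s < t.+1)
      (- ((mu u k - lam u) ^+ 2 / 4) + (mu u k - lam u) * p s)))%:E)%E.
Proof.
move=> lm; set eps := mu u k - lam u; set th := eps / 2.
have /andP[m0 m1] := mu01 u k; have /andP[l0 l1] := lam01 u.
have eps0 : 0 <= eps by rewrite subr_ge0.
have base : (\int[P]_w (expR (th * 0))%:E <= 1)%E.
  by rewrite mulr0 expR0 integral_cst// mul1e probability_le1.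
elim: t => [|t IH].
  rewrite leqn0 => /eqP ->; rewrite [X in (_ <= (expR X)%:E)%E]big_geq// expR0.
  by under eq_integral do rewrite /net_input !big_geq// mulr0n addr0 subr0.
rewrite leq_eqVlt => /orP[/eqP ->|jt].
  rewrite [X in (_ <= (expR X)%:E)%E]big_geq// expR0.
  by under eq_integral do rewrite /net_input !big_geq// mulr0n addr0 subr0.
have {}IH := IH jt.
pose M0 (w : T) : R := expR (th * net_input u k j t w).
pose M1 (w : T) : R := M0 w * (if Arr u t.+1 w then expR th else 1).
pose M2 (w : T) : R := M1 w * (if Srv u k t.+1 w then expR (- th) else 1).
have mM0 i : (forall s, (s <= t)%N -> [/\ arr_index u s != i, coin_index s != i & srv_index u k s != i]) ->
    @dmeas _ (O i) _ M0.
  by move=> hi; exact: (dmeas_comp (fun x : R => expR (th * x)) (others_net_input _ hi)).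
have neq s : (s <= t)%N -> s != t.+1 by move=> st; rewrite neq_ltn ltnS st.
have mM0A : @dmeas _ (O (arr_index u t.+1)) _ M0.
  apply: mM0 => s /neq/eqP st; split=> //; apply/eqP; by case.
have mM0S : @dmeas _ (O (srv_index u k t.+1)) _ M0.
  apply: mM0 => s /neq/eqP st; split=> //; apply/eqP; by case.
have mM0C : @dmeas _ (O (coin_index t.+1)) _ M0.
  apply: mM0 => s /neq/eqP st; split=> //; apply/eqP; by case.
have mM1S : @dmeas _ (O (srv_index u k t.+1)) _ M1.
  have h : @dmeas _ (O (srv_index u k t.+1)) _ (Arr u t.+1) by apply: dmeas_bool; exact: others_arr.
  exact: (dmeas_comp2 (fun (x : R) (b : bool) => x * (if b then expR th else 1)) mM0S h).
have mM2C : @dmeas _ (O (coin_index t.+1)) _ M2.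
  have h : @dmeas _ (O (coin_index t.+1)) _ (Arr u t.+1) by apply: dmeas_bool; exact: others_arr.
  have h' : @dmeas _ (O (coin_index t.+1)) _ (Srv u k t.+1) by apply: dmeas_bool; exact: others_srv.
  have h1 := dmeas_comp2 (fun (x : R) (b : bool) => x * (if b then expR th else 1)) mM0C h.
  exact: (dmeas_comp2 (fun (x : R) (b : bool) => x * (if b then expR (- th) else 1)) h1 h').
have M00 w : 0 <= M0 w by exact: expR_ge0.
have M10 w : 0 <= M1 w by rewrite mulr_ge0//; case: ifP; rewrite ?expR_ge0.
have M20 w : 0 <= M2 w by rewrite mulr_ge0//; case: ifP; rewrite ?expR_ge0.
have GC : G (coin_index t.+1) [set w | Coin t.+1 w] by exists [set true].
have GS : G (srv_index u k t.+1) [set w | Srv u k t.+1 w] by exists [set true].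
have GA : G (arr_index u t.+1) [set w | Arr u t.+1 w] by exists [set true].
rewrite (_ : (\int[P]_w _)%E =
    \int[P]_w (M2 w * (if Coin t.+1 w then expR th else 1))%:E)%E; last first.
  apply: eq_integral => w _; congr EFin; rewrite /M2 /M1 /M0 /net_input !(big_nat_recr t.+1)//=.
  rewrite !natrD; case: (Arr u t.+1 w); case: (Srv u k t.+1 w); case: (Coin t.+1 w) => /=;
    rewrite ?mulr1 -?expRD; congr expR; ring.
rewrite (prim_peel GC (PCoin (ltn0Sn t)) mM2C M20 (expR_ge0 _) ler01).
rewrite (prim_peel GS (PSrv u k (ltn0Sn t)) mM1S M10 (expR_ge0 _) ler01).
rewrite (prim_peel GA (PArr u (ltn0Sn t)) mM0A M00 (expR_ge0 _) ler01).
rewrite !muleA -!EFinM.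
rewrite [X in (_ <= (expR X)%:E)%E]big_nat_recr//= [X in (_ <= X%:E)%E]expRD [leRHS]EFinM [leRHS]muleC.
have /andP[p0 p1] := explore_prob01 R K t.+1.
have th0 : 0 <= th by rewrite /th; lra.
have th1 : th <= 2^-1 by rewrite /th /eps; lra.
have e0 := expR_gt0 th; have e0' := expR_gt0 (- th).
have cmb (q z : R) : 0 <= q <= 1 -> 0 <= z -> 0 <= q * z + (1 - q) * 1.
  by move=> /andP[q0 q1] z0; rewrite addr_ge0// mulr_ge0// subr_ge0.
have cp := cmb _ _ (explore_prob01 R K t.+1) (ltW e0).
have cs := cmb _ _ (mu01 u k) (ltW e0').
have ca := cmb _ _ (lam01 u) (ltW e0).
apply: lee_pmul => //.
- by rewrite lee_fin; apply: mulr_ge0 => //; exact: mulr_ge0.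
- by apply: integral_ge0 => w _; rewrite lee_fin.
rewrite lee_fin -mulrA [leLHS]mulrC expRD; apply: ler_pM => //.
- exact: mulr_ge0.
- apply: le_trans (expR_ge1Dx _).
  have ee : expR th * expR (- th) = 1 by rewrite -expRD subrr expR0.
  have q1 := expR_le_quad th1.
  have q2 : expR (- th) <= 1 + - th + (- th) ^+ 2 by apply: expR_le_quad; lra.
  have -> : (mu u k * expR (- th) + (1 - mu u k) * 1) *
     (lam u * expR th + (1 - lam u) * 1) =
     1 + mu u k * lam u * (expR th * expR (- th) - 1)
       + lam u * (1 - mu u k) * (expR th - 1) +
       mu u k * (1 - lam u) * (expR (- th) - 1) by ring.
  rewrite ee subrr mulr0 addr0.
  have a0 : 0 <= lam u * (1 - mu u k) by rewrite mulr_ge0// subr_ge0.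
  have b0 : 0 <= mu u k * (1 - lam u) by rewrite mulr_ge0// subr_ge0.
  have r1 : lam u * (1 - mu u k) * (expR th - 1) <= lam u * (1 - mu u k) * (th + th ^+ 2).
    by rewrite ler_wpM2l//; lra.
  have r2 : mu u k * (1 - lam u) * (expR (- th) - 1) <= mu u k * (1 - lam u) * (- th + th ^+ 2).
    by rewrite ler_wpM2l//; move: q2; rewrite sqrrN; lra.
  have r3 : (lam u * (1 - mu u k) + mu u k * (1 - lam u)) * th ^+ 2 <= 1 * th ^+ 2.
    by rewrite ler_wpM2r ?sqr_ge0//; nra.
  have r4 : lam u * (1 - mu u k) * (th + th ^+ 2) + mu u k * (1 - lam u) * (- th + th ^+ 2)
     = - (eps ^+ 2 / 2) + (lam u * (1 - mu u k) + mu u k * (1 - lam u)) * th ^+ 2.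
    by rewrite /th /eps; field.
  have r5 : th ^+ 2 = eps ^+ 2 / 4 by rewrite /th; field.
  rewrite -addrA lerD2l; apply: (le_trans (lerD r1 r2)); rewrite r4.
  by move: r3; rewrite mul1r r5; lra.
- have -> : p t.+1 * expR th + (1 - p t.+1) * 1 = 1 + p t.+1 * (expR th - 1) by ring.
  apply: (le_trans (bernoulli_mgf_le p0 th1)); rewrite ler_expR mulrC ler_wpM2r//.
  have : th ^+ 2 <= th * 2^-1 by rewrite expr2 ler_wpM2l.
  rewrite /th; lra.
Qed.

Lemma net_input_ge0_prob u k j t (r : nat) : lam u <= mu u k -> (j <= t)%N ->
  (P [set w | (\sum_(j.+1 <= s < t.+1) Srv u k s w <=
     r + \sum_(j.+1 <= s < t.+1) Arr u s w + \sum_(j.+1 <= s < t.+1) Coin s w)%N] <=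
   (expR ((mu u k - lam u) / 2 * r%:R + \sum_(j.+1 <= s < t.+1)
      (- ((mu u k - lam u) ^+ 2 / 4) + (mu u k - lam u) * p s)))%:E)%E.
Proof.
move=> lm jt; set eps := mu u k - lam u; set B := [set w | _].
have eps0 : 0 <= eps by rewrite subr_ge0.
have mm (X : nat -> T -> bool) : (forall s, measurable [set w | X s w]) ->
    dmeas (fun w => \sum_(j.+1 <= s < t.+1) X s w)%N.
  move=> mX; apply: dmeas_big => s _.
  exact: (dmeas_comp nat_of_bool (dmeas_bool (mX s))).
have m3 := dmeas_pair (dmeas_pair (mm _ (mArr u)) (mm _ mCoin)) (mm _ (mSrv u k)).
have mB : measurable B.
  exact: (dmeas_preimage [set x : nat * nat * nat | (x.2 <= r + x.1.1 + x.1.2)%N] m3).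
pose f w := expR (eps / 2 * r%:R) * expR (eps / 2 * net_input u k j t w).
have mn : dmeas (net_input u k j t).
  exact: (dmeas_comp (fun x : nat * nat * nat => (x.1.1%:R + x.1.2%:R - x.2%:R : R)) m3).
apply: (@markov_bound _ _ _ _ _ f) => //.
- exact: (dmeas_comp (fun x : R => expR (eps / 2 * r%:R) * expR (eps / 2 * x)) mn).
- by move=> w; rewrite mulr_ge0// expR_ge0.
- move=> w Bw; rewrite /f -expRD -[X in X <= _]expR0 ler_expR -mulrDr mulr_ge0//.
    by rewrite divr_ge0.
  by move: Bw; rewrite /B /net_input /= -(ler_nat R) !natrD; lra.
rewrite /f; under eq_integral do rewrite EFinM.
rewrite ge0_integralZl ?lee_fin ?expR_ge0//; last first.
  exact: (dmeas_measurable_fun (fun x => (expR (eps / 2 * x))%:E) mn).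
rewrite expRD EFinM lee_wpmul2l ?lee_fin ?expR_ge0//.
exact: net_input_mgf.
Qed.

(** * Accuracy of the Beta samples and mistakes in exploitation slots *)

Hypothesis PTheta : forall u k t a b B, (1 <= t)%N -> (0 < a)%N -> (0 < b)%N ->
  measurable B -> P (Theta u k t a b @^-1` B) = beta_prob a b B.

(** The pair [ab] lists the possible success and failure counts: before slot [t] both are at most
    [t - 1], hence lie in ['I_t]. *)
Definition theta_off (dl n0 : R) (u : 'I_U) (k : 'I_K) (t : nat) (ab : 'I_t * 'I_t) : set T :=
  [set w | (n0 <= (ab.1 + ab.2)%:R) /\
    dl <= `|Theta u k t ab.1.+1 ab.2.+1 w - ab.1%:R / (ab.1 + ab.2)%:R|].

Arguments theta_off : clear implicits.

Lemma measurable_theta_off dl n0 u k t ab : measurable (theta_off dl n0 u k t ab).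
Proof.
rewrite (_ : theta_off _ _ _ _ _ _ = (if n0 <= (ab.1 + ab.2)%:R then setT else set0) `&`
  (Theta u k t ab.1.+1 ab.2.+1 @^-1` [set y : R | dl <= `|y - ab.1%:R / (ab.1 + ab.2)%:R|])).
  apply: measurableI; first by case: ifP.
  by rewrite -[X in measurable X]setTI; apply: mTheta => //; exact: measurable_deviation.
by apply/seteqP; split=> w /= []; case: ifP.
Qed.

(* The union bound over all posterior parameters makes the dependence between the
   counts and the past irrelevant. *)
Lemma theta_deviation dl n0 u k t : (1 <= t)%N -> 0 < dl <= 1 ->
  (P [set w | exists ab, theta_off dl n0 u k t ab w] <=
   (t%:R ^+ 2 * (2 * t%:R * expR (- (n0 * (dl ^+ 2 / 4)))))%:E)%E.
Proof.
move=> t1 dl01; set b := 2 * t%:R * _.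
have b0 : 0 <= b by rewrite mulr_ge0 ?expR_ge0// mulr_ge0.
rewrite (_ : t%:R ^+ 2 * b = \sum_(ab : 'I_t * 'I_t) b); last first.
  by rewrite sumr_const card_prod card_ord -[RHS]mulr_natl natrM expr2.
apply: prob_exists_le => ab; first exact: measurable_theta_off.
have [nab|nab] := boolP (n0 <= (ab.1 + ab.2)%:R); last first.
  rewrite (_ : theta_off _ _ _ _ _ _ = set0) ?measure0 ?lee_fin//.
  by apply/seteqP; split=> // w [h _]; rewrite h in nab.
rewrite (_ : theta_off _ _ _ _ _ _ = Theta u k t ab.1.+1 ab.2.+1 @^-1`
   [set y : R | dl <= `|y - ab.1%:R / (ab.1 + ab.2)%:R|]); last first.
  by apply/seteqP; split=> w /=; [case|].
rewrite PTheta//; last exact: measurable_deviation.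
apply: (le_trans (beta_tail ab.1 ab.2 dl01)); rewrite lee_fin.
apply: ler_pM; rewrite ?expR_ge0//.
  rewrite -natrM ler_nat; have := ltn_ord ab.1; have := ltn_ord ab.2; lia.
by rewrite ler_expR lerN2 ler_wpM2r// divr_ge0// sqr_ge0.
Qed.

Lemma hist_le t w u k : ((hist t w).1 u k <= t)%N /\ ((hist t w).2 u k <= t)%N.
Proof.
elim: t => [//|t [IH1 IH2]] /=.
by case: (_ == Some k); case: (Srv u k t.+1 w) => /=; split; lia.
Qed.

Variable kstar : 'I_U -> 'I_K.
Hypothesis kstar_inj : injective kstar.
Hypothesis Ecal_explores : exploration_set Ecal.
Hypothesis sel_min : min_mismatch_selector sel.

(** Empirical mean and sample each err by less than [dl], so a sample is within [2 * dl] of its true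
    mean, and a gap of [4 * dl] separates the best server strictly. Accuracy is required for every
    queue, because the selector is forced only when all preferences together form a matching. *)
Lemma exploit_best (dl n0 : R) t w : 0 < n0 ->
  (forall u k, k != kstar u -> 4 * dl <= mu u (kstar u) - mu u k) ->
  ~~ Coin t.+1 w ->
  (forall u k, n0 <= (pulls t u k w)%:R) ->
  (forall u k, `|((hist t w).1 u k)%:R - mu u k * (pulls t u k w)%:R| <
     dl * (pulls t u k w)%:R) ->
  (forall u k ab, ~ theta_off dl n0 u k t.+1 ab w) ->
  forall u, sched_of t.+1 (hist t w) w u = Some (kstar u).
Proof.
move=> n00 gap nC hn hS hT.
have close u k : `|Theta u k t.+1 ((hist t w).1 u k).+1 ((hist t w).2 u k).+1 w - mu u k| < 2 * dl.
  have [h1 h2] := hist_le t w u k.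
  have := hT u k (inord ((hist t w).1 u k), inord ((hist t w).2 u k)).
  rewrite /theta_off /= !inordK// -/(pulls t u k w) => hTk.
  have {hTk} : `|Theta u k t.+1 ((hist t w).1 u k).+1 ((hist t w).2 u k).+1 w -
     ((hist t w).1 u k)%:R / (pulls t u k w)%:R| < dl.
    by rewrite ltNge; apply/negP => h; apply: hTk; split.
  have := hS u k; have n1 := lt_le_trans n00 (hn u k).
  move: (Theta _ _ _ _ _ _) ((hist t w).1 u k)%:R (pulls t u k w)%:R n1 => th s n n1 hs ht.
  have hs' : `|s / n - mu u k| < dl.
    rewrite -(ltr_pM2r n1) -[X in _ * X < _](gtr0_norm n1) -normrM mulrBl.
    by rewrite mulfVK// lt0r_neq0.
  rewrite (_ : th - mu u k = (th - s / n) + (s / n - mu u k)); last by ring.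
  apply: (le_lt_trans (ler_normD _ _)); lra.
have kh u : khat Theta t.+1 (hist t w) w u = Some (kstar u).
  apply: khat_argmax => k kk.
  have := close u k; have := close u (kstar u); have := gap u k kk.
  by rewrite !ltr_norml => g /andP[? ?] /andP[? ?]; lra.
move=> u; rewrite /sched_of (negbTE nC) (selector_matching _ sel_min)//.
by move=> v v' k; rewrite !kh => -[<-] -[] /kstar_inj.
Qed.

(** A mistake requires, for some pair, too few observations, an inaccurate mean or an inaccurate
    sample; the three probabilities are summed over the [U * K] pairs. Only explorations after slot
    [h] are counted. *)
Lemma mistake_bound (dl n0 : R) h t u : 0 < n0 -> 0 < dl <= 1 -> (h <= t)%N ->
  (forall u k, k != kstar u -> 4 * dl <= mu u (kstar u) - mu u k) ->
  (P [set w | ~~ Coin t.+1 w && (sched_of t.+1 (hist t w) w u != Some (kstar u))] <=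
   (U%:R * K%:R * (expR (n0 - \sum_(h.+1 <= r < t.+1) p r / K%:R / 2) +
      (2 + t.+1%:R ^+ 2 * (2 * t.+1%:R)) * expR (- (n0 * (dl ^+ 2 / 4)))))%:E)%E.
Proof.
move=> n00 dl01 ht gap; set b := expR _ + _.
pose A1 (uk : 'I_U * 'I_K) := [set w | (pulls t uk.1 uk.2 w)%:R < n0].
pose A2 (uk : 'I_U * 'I_K) := [set w | (n0 <= (pulls t uk.1 uk.2 w)%:R) &&
     (dl * (pulls t uk.1 uk.2 w)%:R <=
      `|((hist t w).1 uk.1 uk.2)%:R - mu uk.1 uk.2 * (pulls t uk.1 uk.2 w)%:R|)].
pose A3 (uk : 'I_U * 'I_K) := [set w | exists ab, theta_off dl n0 uk.1 uk.2 t.+1 ab w].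
have mh := dmeas_hist_all t.
have mA1 uk : measurable (A1 uk).
  exact: (@dmeas_preimage _ _ _ (hist t) [set c : counts U K |
    (c.1 uk.1 uk.2 + c.2 uk.1 uk.2)%:R < n0] mh).
have mA2 uk : measurable (A2 uk).
  apply: (@dmeas_preimage _ _ _ (hist t) [set h : counts U K |
   (n0 <= (h.1 uk.1 uk.2 + h.2 uk.1 uk.2)%:R) && (dl * (h.1 uk.1 uk.2 + h.2 uk.1 uk.2)%:R <=
     `|(h.1 uk.1 uk.2)%:R - mu uk.1 uk.2 * (h.1 uk.1 uk.2 + h.2 uk.1 uk.2)%:R|)] mh).
have mA3 uk : measurable (A3 uk).
  rewrite (_ : A3 uk = \bigcup_(ab in [set: 'I_t.+1 * 'I_t.+1])
      theta_off dl n0 uk.1 uk.2 t.+1 ab).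
    by apply: fin_bigcup_measurable => // ab _; exact: measurable_theta_off.
  by apply/seteqP; split=> w /= [ab]; [move=> ?; exists ab|move=> _ ?; exists ab].
rewrite (_ : U%:R * K%:R * b = \sum_(uk : 'I_U * 'I_K) b); last first.
  by rewrite sumr_const card_prod !card_ord -[RHS]mulr_natl natrM.
apply: (@prob_le_exists _ _ _ _ _ _ (fun uk => A1 uk `|` (A2 uk `|` A3 uk))).
- have ms : dmeas (fun w => sched_of t.+1 (hist t w) w) by apply: dmeas_sched_of.
  exact: (dmeas_preimage [set x : bool * ('I_U -> option 'I_K) |
     ~~ x.1 && (x.2 u != Some (kstar u))] (dmeas_pair (dmeas_bool (mCoin t.+1)) ms)).
- by move=> uk; apply: measurableU => //; exact: measurableU.
- move=> uk; have [i Ei] := Ecal_explores.2 uk.1 uk.2.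
  rewrite /b mulrDl !EFinD; apply: le_trans (measureU2 P (mA1 uk) _) _ => //.
    exact: measurableU.
  apply: leeD; first exact: few_pulls Ei.
  apply: le_trans (measureU2 P (mA2 uk) (mA3 uk)) _ => //.
  apply: leeD; first exact: estimate_deviation.
  by rewrite -mulrA; exact: theta_deviation.
- move=> w /andP[nC] bad; apply: contrapT => /forallNP good; move/eqP: bad; apply.
  apply: (@exploit_best dl n0) => // [v k|v k|v k ab].
  + by rewrite leNgt; apply/negP => h1; apply: (good (v, k)); left.
  + rewrite ltNge; apply/negP => h1; apply: (good (v, k)); right; left.
    apply/andP; split=> //; rewrite leNgt; apply/negP => h2; apply: (good (v, k)); by left.
  + by move=> h1; apply: (good (v, k)); right; right; exists ab.
Qed.

(** * From rare events to the expected regret *)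

Definition exploit_mistake (u : 'I_U) (s : nat) : set T := [set w | ~~ Coin s w &&
  (sched Ecal sel Srv Coin Pick Theta s w u != Some (kstar u))].
Definition early_or_coin (W s : nat) (w : T) : bool := (s <= W)%N || Coin s w.
(** What a queue not emptied on [(j, t]] forces in the absence of late mistakes, with every slot up
    to [W] written off as lost. The algorithm no longer appears in it. *)
Definition busy_since (u : 'I_U) (W t j : nat) : set T := [set w | (\sum_(j.+1 <= s < t.+1) Srv u (kstar u) s w <=
  (j == 0%N) * Q0 u w + \sum_(j.+1 <= s < t.+1) Arr u s w +
  \sum_(j.+1 <= s < t.+1) early_or_coin W s w)%N].

Lemma dmeas_sum_bool (X : nat -> T -> bool) j t : (forall s, dmeas (X s)) ->
  dmeas (fun w => \sum_(j.+1 <= s < t.+1) X s w)%N.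
Proof.
by move=> mX; apply: dmeas_big => s _; exact: (dmeas_comp nat_of_bool (mX s)).
Qed.

Lemma measurable_busy_since u W t j : measurable (busy_since u W t j).
Proof.
have m1 : dmeas (fun w => \sum_(j.+1 <= s < t.+1) Srv u (kstar u) s w)%N.
  by apply: dmeas_sum_bool => s; exact: dmeas_bool.
have m2 : dmeas (fun w => \sum_(j.+1 <= s < t.+1) Arr u s w)%N.
  by apply: dmeas_sum_bool => s; exact: dmeas_bool.
have m3 : dmeas (fun w => \sum_(j.+1 <= s < t.+1) early_or_coin W s w)%N.
  apply: dmeas_sum_bool => s.
  exact: (dmeas_comp (fun b => (s <= W)%N || b) (dmeas_bool (mCoin s))).
exact: (dmeas_preimage [set x : nat * nat * (nat * nat) |
  (x.1.1 <= (j == 0%N) * x.2.2 + x.1.2 + x.2.1)%N]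
  (dmeas_pair (dmeas_pair m1 m2) (dmeas_pair m3 (dmeas_count (mQ0 u))))).
Qed.

Lemma dmeas_sched s : dmeas (sched Ecal sel Srv Coin Pick Theta s).
Proof. by apply: dmeas_sched_of => //; exact: dmeas_hist_all. Qed.

Lemma measurable_exploit_mistake u s : measurable (exploit_mistake u s).
Proof.
exact: (dmeas_preimage [set x : bool * ('I_U -> option 'I_K) |
   ~~ x.1 && (x.2 u != Some (kstar u))]
   (dmeas_pair (dmeas_bool (mCoin s)) (dmeas_sched s))).
Qed.

Lemma dmeas_served u s : dmeas (served u s).
Proof.
have mSf : dmeas (fun w (p : 'I_U * 'I_K) => Srv p.1 p.2 s w).
  by apply: dmeas_family => x; exact: dmeas_bool.
exact: (dmeas_comp2 (fun (m : 'I_U -> option 'I_K) (f : 'I_U * 'I_K -> bool) =>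
  if m u is Some k then f (u, k) else false) (dmeas_sched s) mSf).
Qed.

(* In the last [N] slots only explorations cost service; outside the two bad events
   the queue has been empty during them. *)
Lemma regret_bound u t N W (bm be pc : R) :
  (W <= t - N)%N -> (N <= t)%N ->
  (forall s, (W < s <= t)%N -> (P (exploit_mistake u s) <= bm%:E)%E) ->
  (forall j, (j < t - N)%N -> (P (busy_since u W t j) <= be%:E)%E) ->
  (forall s, (t - N < s <= t)%N -> p s <= pc) ->
  0 <= bm -> 0 <= be ->
  (\int[P]_w ((queue (Q0 u) (Arr u) (served u) t w)%:R)%:E <=
   \int[P]_w ((queue (Q0 u) (Arr u) (fun s w => Srv u (kstar u) s w) t w)%:R)%:E +
   (N%:R * pc + t%:R * (t%:R * bm + t%:R * be))%:E)%E.
Proof.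
move=> WN Nt hm hb hc bm0 be0.
(* The ordinal [s] stands for slot [s + 1], so that [W <= s] means that the slot is past [W]. *)
pose B1 := [set w | exists s : 'I_t, ((W <= s)%N && (w \in exploit_mistake u s.+1))].
pose B2 := [set w | exists j : 'I_t, ((j < t - N)%N && (w \in busy_since u W t j))].
have splitE (b : bool) (A : set T) : [set w | b && (w \in A)] = if b then A else set0.
  by case: b; apply/seteqP; split=> w //=; rewrite inE.
have finU (I : finType) (b : I -> bool) (A : I -> set T) : (forall i, measurable (A i)) ->
    measurable [set w | exists i, (b i && (w \in A i))].
  move=> mA; rewrite (_ : [set _ | _] =
      \bigcup_(i in [set: I]) [set w | b i && (w \in A i)]).
    by apply: fin_bigcup_measurable => // i _; rewrite splitE; case: ifP.
  by apply/seteqP; split=> w /= [i]; [move=> ?; exists i|move=> _ ?; exists i].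
have mB1 : measurable B1 by apply: finU => s; exact: measurable_exploit_mistake.
have mB2 : measurable B2 by apply: finU => s; exact: measurable_busy_since.
have PB1 : (P B1 <= (t%:R * bm)%:E)%E.
  rewrite (_ : t%:R * bm = \sum_(s : 'I_t) bm); last first.
    by rewrite sumr_const card_ord -[RHS]mulr_natl.
  apply: (@prob_exists_le _ _ _ _ _ (fun (s : 'I_t) => [set w |
    (W <= s)%N && (w \in exploit_mistake u s.+1)])) => s; rewrite splitE; case: ifP => Ws.
  - exact: measurable_exploit_mistake.
  - by [].
  - by apply: hm; rewrite ltnS Ws /=.
  - by rewrite measure0 lee_fin.
have PB2 : (P B2 <= (t%:R * be)%:E)%E.
  rewrite (_ : t%:R * be = \sum_(s : 'I_t) be); last first.
    by rewrite sumr_const card_ord -[RHS]mulr_natl.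
  apply: (@prob_exists_le _ _ _ _ _ (fun (j : 'I_t) => [set w |
    (j < t - N)%N && (w \in busy_since u W t j)])) => s; rewrite splitE; case: ifP => Ws.
  - exact: measurable_busy_since.
  - by [].
  - exact: hb.
  - by rewrite measure0 lee_fin.
pose B := B1 `|` B2.
have mB : measurable B by exact: measurableU.
have PB : (P B <= (t%:R * bm + t%:R * be)%:E)%E.
  by rewrite EFinD; apply: le_trans (measureU2 P mB1 mB2) (leeD PB1 PB2).
pose Q w := queue (Q0 u) (Arr u) (served u) t w.
pose Qg w := queue (Q0 u) (Arr u) (fun s w => Srv u (kstar u) s w) t w.
pose C w := (\sum_((t - N).+1 <= s < t.+1) Coin s w)%N.
have mQ0' := dmeas_count (mQ0 u).
have mQ : dmeas Q.
  by apply: dmeas_queue => // s _; split; [exact: dmeas_bool|exact: dmeas_served].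
have mQg : dmeas Qg.
  by apply: dmeas_queue => // s _; split; exact: dmeas_bool.
have mC : dmeas C by apply: dmeas_sum_bool => s; exact: dmeas_bool.
(* On [B] the crude bound costs [t]. Off [B], mistakes past [W] occur in coin slots only, and a last
   empty time before [t - N] would put [w] into [B2]; the window itself lies past [W]. *)
have pw w : (Q w <= Qg w + (C w + t * (w \in B)))%N.
  pose m s := sched Ecal sel Srv Coin Pick Theta s w u != Some (kstar u).
  have Sm s : (0 < s)%N -> (Srv u (kstar u) s w <= served u s w + m s)%N.
    move=> _; rewrite /m /Defs.served.
    have [->|_] := eqVneq (sched _ _ _ _ _ _ s w u) (Some (kstar u)).
      by rewrite addn0.
    by rewrite addn1; case: (Srv u (kstar u) s w).
  have [wB|wB] := boolP (w \in B).
    rewrite muln1.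
    have := @queue_regret_le T (Q0 u) (Arr u) (served u)
      (fun s w => Srv u (kstar u) s w) w m Sm t.
    rewrite -/(Q w) -/(Qg w); lia.
  rewrite muln0 addn0.
  have nB : ~ B w by move=> Bw; rewrite mem_set in wB.
  have me s : (0 < s <= t)%N -> (m s <= early_or_coin W s w)%N.
    move=> /andP[s0 st]; rewrite /early_or_coin.
    have [_|Ws] := leqP s W; first by case: (m s).
    case: (boolP (Coin s w)) => [_|nC] /=.
      by case: (m s).
    case: (boolP (m s)) => // ms; exfalso; apply: nB; left.
    have st' : (s.-1 < t)%N by lia.
    exists (Ordinal st') => /=; apply/andP; split; first by lia.
    by rewrite prednK// inE /exploit_mistake /= nC.
  have := @queue_regret_window T (Q0 u) (Arr u) (served u)
    (fun s w => Srv u (kstar u) s w) w m Sm (early_or_coin W ^~ w) t N me.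
  rewrite -/(Q w) -/(Qg w) => -[h|[j jt h]].
    apply: (leq_trans h); rewrite leq_add2l /C !big_nat; apply: leq_sum => s /andP[s1 s2].
    have /negbTE sW : ~~ (s <= W)%N by rewrite -ltnNge (leq_ltn_trans WN s1).
    by rewrite /early_or_coin sW.
  exfalso; apply: nB; right; have jt' : (j < t)%N by lia.
  by exists (Ordinal jt') => /=; rewrite jt inE.
have mfun S (X : T -> S) (f : S -> R) : dmeas X ->
    measurable_fun setT (fun w => (f (X w))%:E).
  by move=> mX; exact: (dmeas_measurable_fun (fun x => (f x)%:E) mX).
have mBb : dmeas (fun w => w \in B).
  apply: dmeas_bool; rewrite (_ : [set w | w \in B] = B)//.
  by apply/seteqP; split=> w /=; rewrite inE.
apply: (@le_trans _ _ (\int[P]_w (((Qg w)%:R : R)%:E +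
   (((C w)%:R : R)%:E + (t%:R)%:E * ((w \in B)%:R)%:E)))%E).
  apply: ge0_le_integral => //.
  - exact: (mfun _ _ (fun n : nat => n%:R) mQ).
  - exact: (mfun _ _ (fun x : nat * nat * bool => x.1.1%:R + (x.1.2%:R + t%:R * x.2%:R))
      (dmeas_pair (dmeas_pair mQg mC) mBb)).
  - by move=> w _; rewrite -EFinM -!EFinD lee_fin -natrM -!natrD ler_nat; exact: pw.
rewrite ge0_integralD//; last 3 first.
- exact: (mfun _ _ (fun n : nat => n%:R) mQg).
- by move=> w _; rewrite -EFinM -EFinD lee_fin addr_ge0// mulr_ge0.
- exact: (mfun _ _ (fun x : nat * bool => x.1%:R + t%:R * x.2%:R) (dmeas_pair mC mBb)).
apply: leeD => //.
rewrite ge0_integralD//; last 2 first.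
- exact: (mfun _ _ (fun n : nat => n%:R) mC).
- exact: (mfun _ _ (fun x : bool => t%:R * x%:R) mBb).
rewrite EFinD; apply: leeD.
  have -> : (\int[P]_w ((C w)%:R)%:E = \sum_((t - N).+1 <= s < t.+1) (p s)%:E)%E.
    under eq_integral do rewrite /C natr_sum -sumEFin.
    rewrite ge0_integral_sum//; last first.
      by move=> s; exact: (mfun _ _ (fun x : bool => x%:R) (dmeas_bool (mCoin s))).
    rewrite !big_nat; apply: eq_bigr => s /andP[s1 _].
    rewrite -PCoin; last exact: leq_ltn_trans s1.
    rewrite -[in RHS](setIT [set w | Coin s w]) -integral_indic//.
    apply: eq_integral => w _; rewrite indicE; congr ((_ : bool)%:R)%:E.
    by apply/idP/idP; rewrite inE.
  rewrite sumEFin lee_fin.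
  apply: (@le_trans _ _ (\sum_((t - N).+1 <= s < t.+1) pc)).
    by rewrite !big_nat; apply: ler_sum => s /andP[s1 s2]; apply: hc; rewrite s1.
  by rewrite sumr_const_nat -[leLHS]mulr_natl subSS subKn.
rewrite ge0_integralZl//; last by exact: (mfun _ _ (fun x : bool => x%:R) mBb).
rewrite EFinM lee_wpmul2l ?lee_fin//.
apply: le_trans PB; rewrite -[X in (_ <= P X)%E]setIT -integral_indic//.
Qed.

(** The initial queue enters only for [j = 0]. It is cut at [q], the excess being paid by the
    geometric stationary tail, and the early slots add at most [W - j] to the backlog. *)
Lemma busy_prob u W t j q (pi : nat -> R) : (j <= t)%N ->
  0 < mu u (kstar u) - lam u ->
  is_stationary (lam u) (mu u (kstar u)) pi ->
  (forall n, P [set w | Q0 u w = n] = (pi n)%:E) ->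
  (P (busy_since u W t j) <= (expR ((mu u (kstar u) - lam u) / 2 * ((j == 0%N) * q + (W - j))%:R +
     \sum_(j.+1 <= s < t.+1) (- ((mu u (kstar u) - lam u) ^+ 2 / 4) +
        (mu u (kstar u) - lam u) * p s)) +
     (j == 0%N)%:R * (1 - (mu u (kstar u) - lam u)) ^+ q)%:E)%E.
Proof.
move=> jt eps0 stat PQ.
have /andP[m0 m1] := mu01 u (kstar u); have /andP[l0 l1] := lam01 u.
set r := ((j == 0%N) * q + (W - j))%N.
have mQ0' := dmeas_count (mQ0 u).
pose A1 := [set w | (\sum_(j.+1 <= s < t.+1) Srv u (kstar u) s w <=
     r + \sum_(j.+1 <= s < t.+1) Arr u s w + \sum_(j.+1 <= s < t.+1) Coin s w)%N].
pose A2 := [set w | (j == 0%N) && (q <= Q0 u w)%N].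
have mm (X : nat -> T -> bool) : (forall s, measurable [set w | X s w]) ->
    dmeas (fun w => \sum_(j.+1 <= s < t.+1) X s w)%N.
  by move=> mX; apply: dmeas_sum_bool => s; exact: dmeas_bool.
have m3 := dmeas_pair (dmeas_pair (mm _ (mArr u)) (mm _ mCoin)) (mm _ (mSrv u (kstar u))).
have mA1 : measurable A1.
  exact: (dmeas_preimage [set x : nat * nat * nat | (x.2 <= r + x.1.1 + x.1.2)%N] m3).
have mA2 : measurable A2.
  exact: (dmeas_preimage [set n : nat | (j == 0%N) && (q <= n)%N] mQ0').
rewrite EFinD; apply: (@le_trans _ _ (P A1 + P A2)%E).
  apply: le_trans (measureU2 P mA1 mA2); apply: le_measure; rewrite ?inE//.
  - exact: measurable_busy_since.
  - exact: measurableU.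
  move=> w Bw; have [h|h] := boolP ((j == 0%N) && (q <= Q0 u w)%N); [by right|left].
  rewrite /A1 /=; apply: (leq_trans Bw).
  have h1 : ((j == 0%N) * Q0 u w <= (j == 0%N) * q)%N.
    by move: h; case: (j == 0%N) => //=; rewrite !mul1n -ltnNge; exact: ltnW.
  have h2 : (\sum_(j.+1 <= s < t.+1) early_or_coin W s w <=
      (W - j) + \sum_(j.+1 <= s < t.+1) Coin s w)%N.
    apply: leq_trans (leq_add (sum_early_le W j t) (leqnn _)).
    rewrite -big_split; apply: leq_sum => s _ /=; rewrite /early_or_coin.
    by case: (s <= W)%N; case: (Coin s w).
  move: h1 h2; rewrite /r; lia.
apply: leeD.
  by apply: net_input_ge0_prob => //; rewrite -subr_ge0 ltW.
rewrite /A2; case: (j == 0%N) => /=; last first.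
  rewrite (_ : [set _ | _] = set0) ?measure0 ?mul0r//.
  by apply/seteqP; split.
by rewrite mul1r; apply: (@stationary_tail _ _ _ pi) => //; rewrite -subr_gt0.
Qed.

End Model.

(** * Asymptotic scales *)

Section Scales.
Variable R : realType.

Lemma powR_two_thirds_cube (x : R) : 0 <= x -> (x `^ (2 / 3)) ^+ 3 = x ^+ 2.
Proof.
move=> x0; rewrite -powR_mulrn ?powR_ge0// -powRrM.
by rewrite (_ : 2 / 3 * 3%:R = 2%:R) ?powR_mulrn//; field.
Qed.

(* [l] is log w(t); as [l ^+ 3 = (2 * L / D) ^+ 2], the number [l ^+ 2] of observations
   outgrows every multiple of [L = ln t]. *)
Lemma window_scale (D L : R) : 0 < D <= 1 -> (10 ^+ 5 / D ^+ 2) ^+ 3 <= L ->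
  let l := (2 * L / D) `^ (2 / 3) in
  [/\ 10 <= L, 10 ^+ 5 * L <= D ^+ 2 * l ^+ 2, 60 * L ^+ 2 * (1 + L) <= expR l & 10 <= l].
Proof.
move=> /andP[D0 D1] AL l.
set A := 10 ^+ 5 / D ^+ 2 in AL.
have D2 : 0 < D ^+ 2 <= 1 by rewrite exprn_gt0//= expr_le1// ltW.
have /andP[D20 D21] := D2.
have A1 : 10 ^+ 5 <= A by rewrite /A ler_pdivlMr//; nra.
have A3 : 10 ^+ 5 <= A ^+ 3.
  have : 1 <= A ^+ 2 by rewrite exprn_ege1//; lra.
  by rewrite exprS; nra.
have L2 : 10 ^+ 5 <= L by lra.
have l0 : 0 <= l by exact: powR_ge0.
have l3 : l ^+ 3 = (2 * L / D) ^+ 2.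
  by apply: powR_two_thirds_cube; rewrite divr_ge0 ?ltW//; lra.
have AL0 : 0 <= A * L by rewrite mulr_ge0; lra.
(* Cubes are compared: [l ^+ 6 = 16 * L ^+ 4 / D ^+ 4], while [L ^+ 4 >= A ^+ 3 * L ^+ 3]. This is
   why the threshold on [L] is [A ^+ 3]. *)
have key : A * L <= l ^+ 2.
  rewrite -(@ler_pXn2r _ 3) ?nnegrE ?exprn_ge0//.
  have -> : (l ^+ 2) ^+ 3 = 16 * L ^+ 4 / D ^+ 4.
    by rewrite exprAC l3; field; exact: lt0r_neq0.
  rewrite exprMn.
  have D4 : 0 < D ^+ 4 <= 1 by rewrite exprn_gt0//= expr_le1// ltW.
  have /andP[D40 D41] := D4.
  rewrite ler_pdivlMr//.
  have L3 : 0 <= L ^+ 3 by rewrite exprn_ge0//; lra.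
  apply: (@le_trans _ _ (A ^+ 3 * L ^+ 3)).
    by rewrite ler_piMr// mulr_ge0//; lra.
  rewrite [L ^+ 4]exprS; have := ler_wpM2r L3 AL.
  have : 0 <= L * L ^+ 3 by rewrite mulr_ge0//; lra.
  lra.
have k2 : 10 ^+ 5 * L <= D ^+ 2 * l ^+ 2.
  have := ler_wpM2l (ltW D20) key; rewrite mulrA /A mulrCA divff ?mulr1//.
  exact: lt0r_neq0.
have k3 : 10 ^+ 5 * L <= l ^+ 2.
  have : 0 <= l ^+ 2 by exact: sqr_ge0.
  nra.
split=> //; first by lra.
  (* The term [l ^+ 6 / 6!] of the exponential series is already at least
     [10 ^+ 15 * L ^+ 3 / 720]. *)
  have := @expR_ge1Dxn R l 5 l0.
  rewrite (_ : (6`!)%:R = 720 :> R); last by rewrite -[RHS]/(720%:R).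
  have : (10 ^+ 5 * L) ^+ 3 <= (l ^+ 2) ^+ 3.
    by apply: lerXn2r => //; rewrite nnegrE ?sqr_ge0//; lra.
  rewrite -exprM (_ : (10 ^+ 5 * L) ^+ 3 = 10 ^+ 15 * L ^+ 3); last by ring.
  have : 0 <= L ^+ 3 by rewrite exprn_ge0//; lra.
  have : L ^+ 2 <= L ^+ 3 by rewrite ler_weXn2l//; lra.
  rewrite (_ : 60 * L ^+ 2 * (1 + L) = 60 * L ^+ 2 + 60 * L ^+ 3); last by ring.
  move: (L ^+ 2) (L ^+ 3) (l ^+ 6) (expR l) => x y z e; lra.
rewrite leNgt; apply/negP => l10.
have : l ^+ 2 <= 10 ^+ 2 by apply: lerXn2r; rewrite ?nnegrE//; lra.
rewrite (_ : 10 ^+ 2 = 100 :> R); last by ring.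
lra.
Qed.

Section ExploreProb.
Variable K : nat.
Local Notation p := (explore_prob R K).

Lemma ln_nat_ge0 n : 0 <= ln (n%:R : R).
Proof. by case: n => [|n]; [rewrite ln0|rewrite ln_ge0// ler1n]. Qed.

Lemma ler_ln_nat m n : (0 < m <= n)%N -> ln (m%:R : R) <= ln n%:R.
Proof.
by move=> /andP[m0 mn]; rewrite ler_ln ?posrE ?ltr0n ?ler_nat// (leq_trans m0).
Qed.

Lemma explore_prob_le s t : (0 < s <= t)%N ->
  p s <= 3 * K%:R * ln (t%:R : R) ^+ 2 * s%:R^-1.
Proof.
move=> /andP[s0 st]; rewrite /explore_prob ge_min; apply/orP; right.
rewrite ler_wpM2r ?invr_ge0// ler_wpM2l ?mulr_ge0//.
by apply: lerXn2r; rewrite ?nnegrE ?ln_nat_ge0// ler_ln_nat// s0.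
Qed.

Lemma explore_prob_late s t : (0 < s <= t)%N -> (t <= 2 * s)%N ->
  p s <= 6 * K%:R * ln (t%:R : R) ^+ 2 / t%:R.
Proof.
move=> st ts; apply: (le_trans (explore_prob_le st)).
have /andP[s0 st'] := st; have t0 := leq_trans s0 st'.
have c0 : 0 <= 3 * K%:R * ln (t%:R : R) ^+ 2 by rewrite mulr_ge0 ?sqr_ge0// mulr_ge0.
rewrite (_ : 6 * _ * _ / _ = 3 * K%:R * ln (t%:R : R) ^+ 2 * (2 / t%:R)); last by ring.
rewrite ler_wpM2l// ler_pdivlMr ?ltr0n// mulrC ler_pdivrMr ?ltr0n//.
by rewrite -natrM ler_nat.
Qed.

Lemma explore_prob_sum j t : (0 < t)%N ->
  \sum_(j.+1 <= s < t.+1) p s <= 3 * K%:R * ln (t%:R : R) ^+ 2 * (1 + ln t%:R).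
Proof.
move=> t0.
have c0 : 0 <= 3 * K%:R * ln (t%:R : R) ^+ 2 by rewrite mulr_ge0 ?sqr_ge0// mulr_ge0.
apply: le_trans (ler_wpM2l c0 (harmonic_le_ln R t0)).
rewrite mulr_sumr; have [jt|jt] := leqP j t; last first.
  rewrite [leLHS]big_geq; last by rewrite ltnS ltnW.
  by apply: sumr_ge0 => s _; rewrite mulr_ge0// invr_ge0.
apply: (@le_trans _ _ (\sum_(j.+1 <= s < t.+1) 3 * K%:R * ln (t%:R : R) ^+ 2 * s%:R^-1)).
  rewrite !big_nat; apply: ler_sum => s /andP[s1 s2]; apply: explore_prob_le.
  by rewrite (leq_ltn_trans _ s1).
rewrite [leRHS](@big_cat_nat _ _ _ j.+1)//=.
by rewrite lerDr; apply: sumr_ge0 => s _; rewrite mulr_ge0// invr_ge0.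
Qed.

(** For [r] between [s / 2] and [s] one has [r ^+ 2 >= s], so [ln r >= ln s / 2] and [p r >= q / 4];
    there are at least [s / 4] such slots. The hypothesis that [p] is below 1 at [s] gives [q < 1],
    so the minimum in [p r] does not spoil this bound. *)
Lemma explored_lower (l : R) s' : (0 < K)%N -> 10 <= l -> l <= ln (s'.+1%:R : R) ->
  p s'.+1 < 1 ->
  3 / 32 * l ^+ 2 <= \sum_(s'./2.+1 <= r < s'.+1) p r / K%:R / 2.
Proof.
move=> K0 l10 ls ps; set s := s'.+1.
have K0' : 0 < K%:R :> R by rewrite ltr0n.
have s0 : 0 < s%:R :> R by rewrite ltr0n.
have s11 : 11 <= s%:R :> R.
  have := @expR_ge1Dx R (ln s%:R); rewrite lnK ?posrE//.
  by move: ls; rewrite -/s; lra.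
have s4 : (4 <= s)%N by rewrite -(ler_nat R); lra.
set q := 3 * K%:R * ln (s%:R : R) ^+ 2 / s%:R.
have q1 : q < 1.
  by move: ps; rewrite /explore_prob -/s -/q; rewrite gt_min ltxx.
have step r : (s'./2 < r < s)%N -> 3 / 8 * (ln (s%:R : R) ^+ 2 / s%:R) <= p r / K%:R / 2.
  move=> /andP[r1 r2].
  have r0 : 0 < r%:R :> R by rewrite ltr0n; lia.
  have lr : ln (s%:R : R) / 2 <= ln r%:R.
    have : ln (s%:R : R) <= ln (r%:R ^+ 2).
      rewrite ler_ln ?posrE ?exprn_gt0// -natrX ler_nat.
      by rewrite /s in r1 r2 s4 *; nia.
    by rewrite lnXn// -[_ *+ 2]mulr_natl; lra.
  have l2 : ln (s%:R : R) ^+ 2 / 4 <= ln r%:R ^+ 2.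
    have -> : ln (s%:R : R) ^+ 2 / 4 = (ln s%:R / 2) ^+ 2 by field.
    by apply: lerXn2r; rewrite ?nnegrE ?ln_nat_ge0// divr_ge0// ln_nat_ge0.
  have pr : q / 4 <= p r.
    rewrite /explore_prob le_min; apply/andP; split.
      have : 0 <= q by rewrite /q divr_ge0// mulr_ge0 ?sqr_ge0// mulr_ge0.
      lra.
    rewrite (_ : q / 4 = 3 * K%:R * (ln (s%:R : R) ^+ 2 / 4) / s%:R); last by rewrite /q; field; exact: lt0r_neq0.
    apply: ler_pM.
    - by apply: mulr_ge0; [exact: mulr_ge0|rewrite divr_ge0// sqr_ge0].
    - by rewrite invr_ge0.
    - by rewrite ler_wpM2l// mulr_ge0.
    - by rewrite lef_pV2 ?posrE// ler_nat ltnW.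
  rewrite (_ : 3 / 8 * (ln (s%:R : R) ^+ 2 / s%:R) = q / 4 / K%:R / 2).
    by rewrite !ler_wpM2r// invr_ge0.
  by rewrite /q; field; rewrite !lt0r_neq0.
apply: (@le_trans _ _ (\sum_(s'./2.+1 <= r < s'.+1) 3 / 8 * (ln (s%:R : R) ^+ 2 / s%:R))); last first.
  by rewrite !big_nat; apply: ler_sum => r; exact: step.
rewrite sumr_const_nat -[leRHS]mulr_natl subSS.
have cnt : s%:R / 4 <= (s' - s'./2)%:R :> R.
  rewrite ler_pdivrMr// -natrM ler_nat; rewrite /s in s4 *; lia.
have ll : l ^+ 2 <= ln (s%:R : R) ^+ 2 by apply: lerXn2r; rewrite ?nnegrE ?ln_nat_ge0//; lra.
have c0 : 0 <= 3 / 8 * (ln (s%:R : R) ^+ 2 / s%:R).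
  by rewrite mulr_ge0// divr_ge0// sqr_ge0.
apply: (le_trans _ (ler_wpM2r c0 cnt)).
rewrite (_ : s%:R / 4 * _ = 3 / 32 * ln (s%:R : R) ^+ 2); last by field; exact: lt0r_neq0.
by rewrite ler_wpM2l.
Qed.

End ExploreProb.
End Scales.

(** * Numerical bounds on the two bad events *)

Section FinalEstimates.
Variable R : realType.

(** The threshold [l ^+ 2 / 32] is a third of the guaranteed [S], and [D ^+ 2 * l ^+ 2 / 2048]
    exceeds [12 * L], so both exponentials are at most [t^-12]. The polynomial factors cost at most
    [t^6]. *)
Lemma mistake_estimate (U K t s' : nat) (D L l S : R) : 0 < D <= 1 ->
  L = ln t%:R -> 10 <= L -> 10 ^+ 5 * L <= D ^+ 2 * l ^+ 2 ->
  3 / 32 * l ^+ 2 <= S -> (U <= K)%N -> (K <= t)%N -> (s' < t)%N ->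
  U%:R * K%:R * (expR (l ^+ 2 / 32 - S) +
    (2 + s'.+1%:R ^+ 2 * (2 * s'.+1%:R)) *
       expR (- (l ^+ 2 / 32 * ((D / 4) ^+ 2 / 4)))) <= expR (- (3 * L)).
Proof.
move=> /andP[D0 D1] LE L10 Dl lS UK Kt st.
have t0 : 0 < t%:R :> R by rewrite ltr0n (leq_ltn_trans _ st).
have xE : t%:R = expR L by rewrite LE lnK ?posrE.
have x11 : 11 <= t%:R :> R by rewrite xE; have := @expR_ge1Dx R L; lra.
have l2 : 0 <= l ^+ 2 by exact: sqr_ge0.
have D21 : D ^+ 2 <= 1 by rewrite expr_le1// ltW.
have D20 : 0 <= D ^+ 2 by exact: sqr_ge0.
have Ll : 10 ^+ 5 * L <= l ^+ 2 by apply: (le_trans Dl); rewrite ler_piMl.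
have e1 : expR (l ^+ 2 / 32 - S) <= expR (- (12 * L)) by rewrite ler_expR; lra.
have e2 : expR (- (l ^+ 2 / 32 * ((D / 4) ^+ 2 / 4))) <= expR (- (12 * L)).
  rewrite ler_expR lerN2 (_ : _ * (_ / 4) = D ^+ 2 * l ^+ 2 / 2048); first by lra.
  by field.
have sx : s'.+1%:R <= t%:R :> R by rewrite ler_nat.
have s3 : s'.+1%:R ^+ 2 * (2 * s'.+1%:R) <= 2 * t%:R ^+ 3 :> R.
  rewrite (_ : s'.+1%:R ^+ 2 * (2 * s'.+1%:R) = 2 * s'.+1%:R ^+ 3); last by ring.
  by rewrite ler_wpM2l// lerXn2r// ?nnegrE.
have t3 : 1 <= t%:R ^+ 3 :> R by rewrite exprn_ege1//; lra.
set E := expR (- (12 * L)) in e1 e2.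
have E0 : 0 <= E by exact: expR_ge0.
apply: (@le_trans _ _ (t%:R ^+ 2 * (t%:R ^+ 4 * E))).
  apply: ler_pM.
  - by rewrite mulr_ge0.
  - rewrite addr_ge0 ?expR_ge0// mulr_ge0 ?expR_ge0// addr_ge0//.
  - by rewrite expr2 -!natrM ler_nat leq_mul// (leq_trans UK).
  have f1 : 5 * (t%:R ^+ 3 * E) <= t%:R ^+ 4 * E.
    by rewrite [t%:R ^+ 4]exprS -mulrA ler_wpM2r ?mulr_ge0//; lra.
  have f2 : E <= t%:R ^+ 3 * E by rewrite ler_peMl.
  have f3 : (2 + s'.+1%:R ^+ 2 * (2 * s'.+1%:R)) *
       expR (- (l ^+ 2 / 32 * ((D / 4) ^+ 2 / 4))) <= 2 * E + 2 * (t%:R ^+ 3 * E).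
    rewrite (_ : 2 * E + _ = (2 + 2 * t%:R ^+ 3) * E); last by ring.
    by apply: ler_pM; rewrite ?expR_ge0 ?lerD2l.
  apply: (le_trans (lerD e1 f3)); lra.
by rewrite mulrA -exprD xE /E -expRM_natl -expRD ler_expR; lra.
Qed.

(** The drift [n * eps ^+ 2 / 4] must pay for explorations, early slots, initial queue and [3 * L].
    A small exploration probability per slot is available only in the second half of the horizon,
    whence two regimes for [j]. *)
Lemma busy_estimate (K t j N W q : nat) (eps L wt v : R) :
  0 < eps <= 1 -> (2 <= K)%N -> (0 < t)%N -> L = ln t%:R -> 10 <= L ->
  60 * L ^+ 2 * (1 + L) <= wt -> 12 * K%:R * wt <= eps * t%:R ->
  24 * L <= v * eps ^+ 2 -> v <= t%:R / 2 -> v < N.+1%:R ->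
  W%:R <= wt -> q%:R <= 3 * L / eps + 1 -> (j < t - N)%N ->
  eps / 2 * ((j == 0%N) * q + (W - j))%:R +
    \sum_(j.+1 <= s < t.+1) (- (eps ^+ 2 / 4) + eps * explore_prob R K s)
  <= - (3 * L).
Proof.
move=> /andP[e0 e1] K2 t0 LE L10 wL Kw vL vt vN Ww qL jN.
have jt : (j < t)%N by lia.
have t0' : 0 < t%:R :> R by rewrite ltr0n.
have K2' : 2 <= K%:R :> R by rewrite (ler_nat R 2).
set n : R := (t - j)%:R.
have nE : n = t%:R - j%:R by rewrite /n natrB// ltnW.
have nv : v <= n.
  by apply: (le_trans (ltW vN)); rewrite /n ler_nat; move: jN; clear; lia.
have e20 : 0 < eps ^+ 2 by rewrite exprn_gt0.
have nL : 24 * L <= n * eps ^+ 2 by apply: (le_trans vL); rewrite ler_wpM2r// ltW.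
rewrite big_split /= sumr_const_nat subSS -mulr_sumr -/n.
rewrite -[(- (eps ^+ 2 / 4)) *+ _]mulr_natl -/n.
set Sp := \sum_(j.+1 <= s < t.+1) _.
have L2 : 0 <= L ^+ 2 by exact: sqr_ge0.
have w4 : 4 * L ^+ 2 <= wt by nra.
have w0 : 0 <= wt by lra.
have wt12 : wt <= t%:R / 12.
  have : 2 * wt <= K%:R * wt by rewrite ler_wpM2r.
  have : eps * t%:R <= 1 * t%:R by rewrite ler_wpM2r// ltW.
  lra.
(* If [j >= t / 2], initial queue and early slots drop out, since [W <= t / 12], and each
   exploration probability is at most [eps / 8]. Half of the drift is left, and
   [n * eps ^+ 2 >= 24 * L] makes it at least [3 * L]; this uses the 24 in [v]. *)
have [tj|tj] := leqP t (2 * j).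
  have tj' : t%:R <= 2 * j%:R :> R by rewrite -natrM ler_nat.
  have Wj : (W <= j)%N by rewrite -(ler_nat R); lra.
  have -> : (j == 0%N) = false by apply/negbTE; move: t0 tj; clear; lia.
  rewrite mul0n add0n (eqP (_ : W - j == 0)%N) ?subn_eq0// mulr0 add0r.
  have : Sp <= n * (eps / 8).
    rewrite /n -subSS mulr_natl -sumr_const_nat /Sp !big_nat; apply: ler_sum => s /andP[s1 s2].
    have sle : (0 < s <= t)%N by move: s1 s2; clear; lia.
    have ts : (t <= 2 * s)%N by move: s1 tj; clear; lia.
    apply: (le_trans (explore_prob_late R K sle ts)).
    rewrite -LE ler_pdivrMr//.
    have : K%:R * (4 * L ^+ 2) <= K%:R * wt by rewrite ler_wpM2l.
    lra.
  move=> /(ler_wpM2l (ltW e0)); rewrite mulrCA (_ : eps * (eps / 8) = eps ^+ 2 / 8); last by field.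
  lra.
(* If [j < t / 2], the long stretch [n >= t / 2] gives [n * eps ^+ 2 >= 6 * eps * K * wt], which
   pays for the early slots and for all explorations, summed harmonically. *)
have nt : t%:R / 2 <= n.
  have : 2 * j%:R <= t%:R :> R by rewrite -natrM ler_nat ltnW.
  by rewrite nE; lra.
have Sp1 : Sp <= K%:R * wt / 20.
  apply: (le_trans (explore_prob_sum R K j t0)); rewrite -LE.
  have : K%:R * (60 * L ^+ 2 * (1 + L)) <= K%:R * wt by rewrite ler_wpM2l.
  lra.
have r1 : ((j == 0%N) * q + (W - j))%:R <= 3 * L / eps + 1 + wt.
  rewrite natrD natrM lerD//.
    by case: (j == 0%N); rewrite ?mul1r// mul0r addr_ge0// divr_ge0 ?ltW//; lra.
  by apply: le_trans Ww; rewrite ler_nat leq_subr.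
have r2 : eps / 2 * ((j == 0%N) * q + (W - j))%:R <= 3 / 2 * L + eps / 2 + eps * wt / 2.
  have e2 : 0 <= eps / 2 by rewrite divr_ge0// ltW.
  apply: (le_trans (ler_wpM2l e2 r1)).
  rewrite (_ : eps / 2 * (3 * L / eps + 1 + wt) = 3 / 2 * L + eps / 2 + eps * wt / 2)//.
  by field; exact: lt0r_neq0.
have r3 : eps * Sp <= eps * (K%:R * wt / 20) by rewrite ler_wpM2l// ltW.
have r4 : eps * (2 * wt) <= eps * (K%:R * wt).
  by apply: ler_wpM2l; [exact: ltW|exact: ler_wpM2r].
have r5 : t%:R / 2 * eps ^+ 2 <= n * eps ^+ 2 by rewrite ler_wpM2r// ltW.
have r6 : eps * (12 * K%:R * wt) <= eps * (eps * t%:R) by rewrite ler_wpM2l// ltW.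
have r7 : v * eps ^+ 2 <= t%:R / 2 * eps ^+ 2 by rewrite ler_wpM2r// ltW.
have E1 : t%:R / 2 * eps ^+ 2 = eps * (eps * t%:R) / 2 by field.
have E2 : eps * (12 * K%:R * wt) = 12 * (eps * (K%:R * wt)) by ring.
have E3 : n * - (eps ^+ 2 / 4) = - (n * eps ^+ 2) / 4 by field.
have E4 : eps * (K%:R * wt / 20) = eps * (K%:R * wt) / 20 by field.
have E5 : eps * (2 * wt) = 2 * (eps * wt) by ring.
rewrite E3; rewrite E1 in r5 r7; rewrite E2 in r6; rewrite E4 in r3; rewrite E5 in r4.
move: (eps * (K%:R * wt)) (eps * (eps * t%:R)) (n * eps ^+ 2) (eps * Sp)
  (eps * wt) (eps / 2 * _) (v * eps ^+ 2) r2 r3 r4 r5 r6 r7 vL nL {E1 E2 E3 E4 E5 wL Kw vt vN nv nt Sp1 r1}.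
move=> a b c e f g h; lra.
Qed.

End FinalEstimates.

(** * Assembling the regret bound *)

Unset Implicit Arguments.

Theorem theorem4 (R : realType) (Delta : R) :
  exists C : R, 0 < C /\ exists t0 : R,
  forall (U K : nat) (lam : 'I_U -> R) (mu : 'I_U -> 'I_K -> R)
    (kstar : 'I_U -> 'I_K)
    (Ecal : 'I_K -> 'I_U -> option 'I_K)
    (sel : nat -> ('I_U -> option 'I_K) -> ('I_U -> option 'I_K))
    (d : measure_display) (T : measurableType d) (P : probability T R)
    (Arr : 'I_U -> nat -> T -> bool) (Srv : 'I_U -> 'I_K -> nat -> T -> bool)
    (Coin : nat -> T -> bool) (Pick : nat -> T -> 'I_K)
    (Theta : 'I_U -> 'I_K -> nat -> nat -> nat -> T -> R)
    (Q0 : 'I_U -> T -> nat) (pi : 'I_U -> nat -> R),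
  (* the instance *)
  (1 <= U)%N -> (U <= K)%N ->
  (forall u, 0 <= lam u <= 1) -> (forall u k, 0 <= mu u k <= 1) ->
  (forall u k, k != kstar u -> mu u k < mu u (kstar u)) ->
  injective kstar ->
  (forall u, 0 < mu u (kstar u) - lam u) ->
  (* Delta = min_{u, k <> k*_u} (mu*_u - mu_uk) *)
  (forall u k, k != kstar u -> Delta <= mu u (kstar u) - mu u k) ->
  (exists u k, k != kstar u /\ Delta = mu u (kstar u) - mu u k) ->
  (* the algorithm's parameters *)
  exploration_set Ecal -> min_mismatch_selector sel ->
  (* the primitive random variables: measurability *)
  (forall u t, measurable [set w | Arr u t w]) ->
  (forall u k t, measurable [set w | Srv u k t w]) ->
  (forall t, measurable [set w | Coin t w]) ->
  (forall t i, measurable [set w | Pick t w = i]) ->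
  (forall u k t a b, measurable_fun setT (Theta u k t a b)) ->
  (forall u n, measurable [set w | Q0 u w = n]) ->
  (* their laws *)
  (forall u t, (1 <= t)%N -> P [set w | Arr u t w] = (lam u)%:E) ->
  (forall u k t, (1 <= t)%N -> P [set w | Srv u k t w] = (mu u k)%:E) ->
  (forall t, (1 <= t)%N -> P [set w | Coin t w] = (explore_prob R K t)%:E) ->
  (forall t i, (1 <= t)%N -> P [set w | Pick t w = i] = (K%:R^-1)%:E) ->
  (forall u k t a b B, (1 <= t)%N -> (0 < a)%N -> (0 < b)%N -> measurable B ->
     P (Theta u k t a b @^-1` B) = beta_prob a b B) ->
  (forall u, is_stationary (lam u) (mu u (kstar u)) (pi u)) ->
  (forall u n, P [set w | Q0 u w = n] = (pi u n)%:E) ->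
  (* mutual independence of all of them *)
  mutually_independent P (prim_events Arr Srv Coin Pick Theta Q0) ->
  forall (u : 'I_U) (t : nat),
  let eps := mu u (kstar u) - lam u in
  let lt := ln (t%:R : R) in
  let wt := expR ((2 * lt / Delta) `^ (2 / 3)) in
  let v' := 6 * K%:R / eps * wt in
  let v := 24 / eps ^+ 2 * lt + 60 * K%:R / eps * (v' * lt ^+ 2 / t%:R) in
  t0 < t%:R ->
  2 / eps <= wt / lt ->
  expR (6 / Delta ^+ 2) <= t%:R ->
  v + v' <= t%:R / 2 ->
  (\int[P]_w ((queue (Q0 u) (Arr u)
                 (served Ecal sel Srv Coin Pick Theta u) t w)%:R)%:E
   - \int[P]_w ((queue (Q0 u) (Arr u) (fun s w => Srv u (kstar u) s w) t w)%:R)%:E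
   <= (C * (K%:R * v * lt ^+ 2 / t%:R))%:E)%E.
Proof.
(* Of the 9, a 6 comes from the exploration probability [6 K log^2 t / t] over a window of at most
   [v] slots and a 3 from the bad events. The threshold gives [ln t] the size that [window_scale]
   asks for. *)
exists 9; split; first by []; exists (expR ((10 ^+ 5 / Delta ^+ 2) ^+ 3)).
move=> U K lam mu kstar Ecal sel d T P Arr Srv Coin Pick Theta Q0 pi U1 UK lam01 mu01.
move=> kbest kinj epspos gap [ug [kg [kgP gapE]]] hE hsel mArr mSrv mCoin mPick mTheta mQ0.
move=> PArr PSrv PCoin PPick PTheta stat PQ0 indep u t eps lt wt v' v tt0 _ _ vvt.
have D0 : 0 < Delta by rewrite gapE subr_gt0 kbest.
have D1 : Delta <= 1.
  by rewrite gapE; have := mu01 ug kg; have := mu01 ug (kstar ug); lra.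
have D01 : 0 < Delta <= 1 by rewrite D0.
have d01 : 0 < Delta / 4 <= 1 by lra.
have gap4 u' k : k != kstar u' -> 4 * (Delta / 4) <= mu u' (kstar u') - mu u' k.
  by move=> /gap; lra.
(* [Delta] is attained at a server other than the best one, so there are at least two servers. *)
have K2 : (2 <= K)%N.
  have := ltn_ord (kstar ug); have := ltn_ord kg; have := kgP; rewrite -val_eqE /=.
  by move: (nat_of_ord kg) (nat_of_ord (kstar ug)) => a b; clear; lia.
have e0 : 0 < eps by exact: epspos.
have e1 : eps <= 1.
  by rewrite /eps; have := mu01 u (kstar u); have := lam01 u; lra.
have t0' : 0 < t%:R :> R by apply: lt_trans tt0; exact: expR_gt0.
have t0 : (0 < t)%N by rewrite ltr0n in t0'.
have tE : t%:R = expR lt by rewrite /lt lnK ?posrE.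
have AL : (10 ^+ 5 / Delta ^+ 2) ^+ 3 <= lt.
  by apply/ltW; rewrite -ltr_expR -tE.
set l := (2 * lt / Delta) `^ (2 / 3).
have [L10 Dl wL l10] := window_scale D01 AL; rewrite -/l -/wt in Dl wL l10.
have w0 : 0 < wt by exact: expR_gt0.
have K0 : 0 < K%:R :> R by rewrite ltr0n (leq_trans _ K2).
have v'0 : 0 <= v'.
  by rewrite /v' mulr_ge0 ?(ltW w0)// divr_ge0 ?(ltW e0)// mulr_ge0.
have e20 : 0 < eps ^+ 2 by exact: exprn_gt0.
have v1 : 24 / eps ^+ 2 * lt <= v.
  rewrite /v lerDl mulr_ge0//; first by rewrite divr_ge0 ?(ltW e0)// mulr_ge0.
  by rewrite divr_ge0// mulr_ge0// sqr_ge0.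
have lt0 : 0 <= lt by lra.
have vL : 24 * lt <= v * eps ^+ 2.
  move: v1; rewrite -(ler_pM2r e20) (_ : 24 / eps ^+ 2 * lt * eps ^+ 2 = 24 * lt)//.
  by field; exact: lt0r_neq0.
have v0 : 0 <= v.
  by apply: le_trans v1; rewrite mulr_ge0// divr_ge0// ltW.
have vt : v <= t%:R / 2 by lra.
have Kw : 12 * K%:R * wt <= eps * t%:R.
  have : v' <= t%:R / 2 by lra.
  rewrite /v' -(ler_pM2l e0) (_ : eps * (6 * K%:R / eps * wt) = 6 * K%:R * wt); first by lra.
  by field; exact: lt0r_neq0.
have wt12 : 12 * wt <= t%:R.
  have : 1 * wt <= K%:R * wt by rewrite ler_wpM2r ?(ltW w0)// ler1n (leq_trans _ K2).
  have : eps * t%:R <= 1 * t%:R by rewrite ler_wpM2r// ltW.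
  lra.
have Kt : (K <= t)%N.
  rewrite -(ler_nat R).
  have : eps * t%:R <= 1 * t%:R by rewrite ler_wpM2r// ltW.
  have : K%:R * 1 <= K%:R * wt.
    by rewrite ler_wpM2l ?(ltW K0)// /wt -[X in X <= _]expR0 ler_expR powR_ge0.
  lra.
set W := Num.trunc wt; set N := Num.trunc v.
have /andP[W1 W2] : W%:R <= wt < W.+1%:R by apply: truncn_itv; exact: ltW.
have /andP[N1 N2] : N%:R <= v < N.+1%:R by exact: truncn_itv.
have WN : (W + N <= t)%N by rewrite -(ler_nat R) natrD; lra.
have NN : (2 * N <= t)%N by rewrite -(ler_nat R) natrM; lra.
(* [bm] is [t^-3], and [q] is the least natural number above [3 * lt / eps], so that the geometric
   tail [(1 - eps) ^+ q] is at most [bm]. *)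
set bm := expR (- (3 * lt)).
set q := (Num.trunc (3 * lt / eps)).+1.
have q0 : 0 <= 3 * lt / eps by rewrite divr_ge0 ?(ltW e0)// mulr_ge0.
have /andP[q1 q2] : (q.-1)%:R <= 3 * lt / eps < q%:R by exact: truncn_itv.
have tail : (1 - eps) ^+ q <= bm.
  apply: (@le_trans _ _ (expR (- eps) ^+ q)).
    by apply: lerXn2r; rewrite ?nnegrE ?expR_ge0 ?subr_ge0//; exact: expR_ge1Dx.
  rewrite -expRM_natl ler_expR mulrN lerN2.
  move: q2; rewrite ltr_pdivrMr//; exact: ltW.
have qle : q%:R <= 3 * lt / eps + 1 by rewrite -[q]/(q.-1.+1) -natr1 lerD2r.
have hmist s : (W < s <= t)%N ->
    (P (exploit_mistake Ecal sel Srv Coin Pick Theta kstar u s) <= bm%:E)%E.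
  case: s => [//|s'] /andP[Ws st].
  have ls : l <= ln (s'.+1%:R : R).
    rewrite -[l]expRK ler_ln ?posrE ?expR_gt0 ?ltr0n//.
    by apply: (le_trans (ltW W2)); rewrite ler_nat.
  (* When the exploration probability is 1, almost surely the slot explores and an exploitation
     mistake has probability 0. *)
  have [/eqP p1|p1] := boolP (explore_prob R K s'.+1 == 1).
    apply: (@le_trans _ _ (P (~` [set w | Coin s'.+1 w]))).
      apply: le_measure; rewrite ?inE.
      - exact: measurable_exploit_mistake.
      - exact: measurableC.
      - by move=> w /andP[/negP].
    rewrite probability_setC// PCoin// p1 subee// lee_fin; exact: expR_ge0.
  have p1' : explore_prob R K s'.+1 < 1.
    by rewrite lt_neqAle p1; have /andP[] := explore_prob01 R K s'.+1.
  have n00 : 0 < l ^+ 2 / 32 by rewrite divr_gt0// exprn_gt0// (lt_le_trans _ l10).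
  have hh : (s'./2 <= s')%N by clear; lia.
  have := mistake_bound mu01 mArr mSrv mCoin mPick mTheta mQ0 PSrv PCoin PPick indep
    PTheta kinj hE hsel u n00 d01 hh gap4.
  move/le_trans; apply; rewrite lee_fin.
  apply: (mistake_estimate D01 (erefl lt)) => //.
  by apply: explored_lower => //; exact: leq_trans K2.
have hbusy j : (j < t - N)%N ->
    (P (busy_since Arr Srv Coin Q0 kstar u W t j) <= (2 * bm)%:E)%E.
  move=> jN; have jt : (j <= t)%N by move: jN; clear; lia.
  have := busy_prob mu01 lam01 mArr mSrv mCoin mPick mTheta mQ0 PArr PSrv PCoin indep
    W q jt e0 (stat u) (PQ0 u).
  move/le_trans; apply; rewrite lee_fin (_ : 2 * bm = bm + bm); last by ring.
  apply: lerD.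
    rewrite ler_expR; apply: (@busy_estimate _ _ _ _ N _ _ _ _ wt v) => //.
    by rewrite e0.
  by case: (j == 0%N); rewrite ?mul1r// mul0r expR_ge0.
have hp s : (t - N < s <= t)%N ->
    explore_prob R K s <= 6 * K%:R * lt ^+ 2 / t%:R.
  move=> /andP[s1 s2]; apply: explore_prob_late; move: NN s1 s2 t0; clear; lia.
have WN' : (W <= t - N)%N by move: WN; clear; lia.
have Nt : (N <= t)%N by move: WN; clear; lia.
have bm0 : 0 <= bm by exact: expR_ge0.
have be0 : 0 <= 2 * bm by rewrite mulr_ge0.
have := regret_bound mArr mSrv mCoin mPick mTheta mQ0 PCoin WN' Nt hmist hbusy hp bm0 be0.
set I1 := (\int[P]_w _)%E; set I2 := (\int[P]_w _)%E; set X := (_ + _ * _) => main.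
have I20 : (0 <= I2)%E by apply: integral_ge0 => w _; rewrite lee_fin.
have XC : X <= 9 * (K%:R * v * lt ^+ 2 / t%:R).
  have b3 : t%:R * (t%:R * bm + t%:R * (2 * bm)) = 3 / t%:R.
    have -> : t%:R * (t%:R * bm + t%:R * (2 * bm)) = 3 * (t%:R * t%:R * bm) by ring.
    by rewrite /bm tE -!expRD -expRN; congr (_ * expR _); ring.
  rewrite /X b3.
  have n1 : N%:R * (6 * K%:R * lt ^+ 2 / t%:R) <= v * (6 * K%:R * lt ^+ 2 / t%:R).
    by rewrite ler_wpM2r// divr_ge0// mulr_ge0 ?sqr_ge0// mulr_ge0.
  have n2 : 1 <= K%:R * v * lt ^+ 2.
    have k1 : 1 <= K%:R :> R by rewrite ler1n (leq_trans _ K2).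
    have vv : 1 <= v.
      apply: le_trans v1; rewrite -[24 / _ * _]mulrA [_^-1 * _]mulrC mulrA ler_pdivlMr// mul1r.
      have : eps ^+ 2 <= 1 by rewrite expr_le1// ltW.
      by move: L10; clear; lra.
    have l2 : 1 <= lt ^+ 2.
      by rewrite exprn_ege1// (le_trans _ L10)//; clear; lra.
    by rewrite mulr_ege1// mulr_ege1.
  have n3 : 3 / t%:R <= 3 * (K%:R * v * lt ^+ 2) / t%:R.
    by rewrite ler_wpM2r ?invr_ge0// ler_peMr.
  apply: (le_trans (lerD n1 n3)); rewrite le_eqVlt; apply/orP; left; apply/eqP.
  by field; exact: lt0r_neq0.
(* Were the genie expectation infinite, the extended difference would be [-oo] by convention. *)
have [I2f|] := boolP (I2 \is a fin_num).
  rewrite leeBlDr// addeC; apply: (le_trans main); rewrite leeD2l// lee_fin.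
rewrite ge0_fin_numE// -leNgt leye_eq => /eqP ->.
by rewrite /= addeNy leNye.
Qed.
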